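(* (Operator Theorem) Let $n,r\ge1$ be integers. The inverse system $SI_{n,r}^\perp$ is the smallest $\mathbb{C}$-linear subspace of $\Omega$ which (i) contains the polynomial $\delta_{n,r}\in S=\mathbb{C}[x_1,\dots,x_n]$, (ii) is closed under the partial derivatives $\partial_1,\dots,\partial_n$, and (iii) is closed under the higher Euler operators $d_1,d_{r+1},d_{2r+1},\dots,d_{(n-1)r+1}$.
   Context: Let $\zeta=\exp(2\pi i/r)$. $\mathbb{Z}_r\wr\mathfrak{S}_n$ is the group of $n\times n$ complex monomial matrices (exactly one nonzero entry in each row and column) whose nonzero entries are $r$-th roots of unity. $S=\mathbb{C}[x_1,\dots,x_n]$, and $\Omega=S\otimes\wedge\{\theta_1,\dots,\theta_n\}$ is the unital associative $\mathbb{C}$-algebra generated by $x_i,\theta_i$ with relations $x_ix_j=x_jx_i$, $x_i\theta_j=\theta_jx_i$, $\theta_i\theta_j=-\theta_j\theta_i$. The group acts on $\Omega$ by algebra automorphisms: $\mathrm{diag}(\zeta^{c_1},\dots,\zeta^{c_n})$ sends $x_i\mapsto\zeta^{-c_i}x_i$, $\theta_i\mapsto\zeta^{-c_i}\theta_i$, and a permutation matrix $w$ sends $x_i\mapsto x_{w(i)}$, $\theta_i\mapsto\theta_{w(i)}$. $SI_{n,r}\subseteq\Omega$ is the two-sided ideal generated by all $(\mathbb{Z}_r\wr\mathfrak{S}_n)$-invariant elements with vanishing constant term. $\partial_i$ is partial differentiation in $x_i$, acting on $\Omega$ through the factor $S$. $\partial_i^\theta:\Omega\to\Omega$ is the $S$-linear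 contraction operator: for distinct $j_1,\dots,j_k$, $\partial_i^\theta(\theta_{j_1}\cdots\theta_{j_k})=(-1)^{s-1}\theta_{j_1}\cdots\widehat{\theta_{j_s}}\cdots\theta_{j_k}$ if $j_s=i$, and $0$ if $i\notin\{j_1,\dots,j_k\}$. For $f\in\Omega$, $f\odot g$ is the result of applying to $g\in\Omega$ the operator obtained from $f$ by replacing $x_i\to\partial_i$, $\theta_i\to\partial_i^\theta$. For a bigraded ideal $I\subseteq\Omega$, the inverse system is $I^\perp:=\{g\in\Omega: f\odot g=0\text{ for all }f\in I\}$. For $j\ge1$ the higher Euler operator $d_j:\Omega\to\Omega$ is $d_j(f):=\sum_{i=1}^n(\partial_i^jf)\cdot\theta_i$. Finally $\delta_{n,r}:=(x_1\cdots x_n)^{r-1}\prod_{1\le i<j\le n}(x_i^r-x_j^r)$. *)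

(* Defs.v *)
From HB Require Import structures.
From mathcomp Require Import all_boot all_order all_fingroup all_algebra.
From mathcomp Require Import mpoly.

Set Implicit Arguments.
Unset Strict Implicit.
Unset Printing Implicit Defensive.

Import GRing.Theory.
Local Open Scope ring_scope.

(* f : Omega K n stands for \sum_A f A * theta_A, where theta_A is the product
   of the theta_i for i in A, taken in increasing order. *)
Definition Omega (K : fieldType) (n : nat) := {ffun {set 'I_n} -> {mpoly K[n]}}.

(* theta_A * theta_B = (-1) ^ (inversions A B) * theta_(A :|: B) when A and B
   are disjoint *)
Definition inversions (n : nat) (A B : {set 'I_n}) : nat :=
  (\sum_(a in A) #|[set b in B | (b < a)%N]|)%N.

Section OmegaAlgebra.
Variables (K : fieldType) (n : nat).
Local Notation Om := (Omega K n).

HB.instance Definition _ :=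
  GRing.Lmodule.copy Om {ffun {set 'I_n} -> {mpoly K[n]}}.

Definition omega_one : Om := [ffun U : {set 'I_n} => (U == set0)%:R].

Definition omega_mul (f g : Om) : Om :=
  [ffun U : {set 'I_n} => \sum_(A : {set 'I_n} | A \subset U)
     (-1) ^+ inversions A (U :\: A) * (f A * g (U :\: A))].

Lemma inversions_setUl (A B C : {set 'I_n}) : [disjoint A & B] ->
  inversions (A :|: B) C = (inversions A C + inversions B C)%N.
Proof. by move=> dAB; rewrite /inversions -bigU //; apply: eq_bigl => i; rewrite !inE. Qed.

Lemma inversions_setUr (A B C : {set 'I_n}) : [disjoint B & C] ->
  inversions A (B :|: C) = (inversions A B + inversions A C)%N.
Proof.
move=> dBC; rewrite /inversions -big_split /=; apply: eq_bigr => a _.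
rewrite -cardsUI [X in (_ + #|pred_of_set X|)%N](_ : _ = set0) ?cards0 ?addn0.
  by apply: eq_card => b; rewrite !inE andb_orl.
apply/setP=> b; rewrite !inE; case bB: (b \in B) => //=.
by rewrite (disjointFr dBC bB) andbF.
Qed.

Lemma inversions0l (A : {set 'I_n}) : inversions set0 A = 0%N.
Proof. by rewrite /inversions big_set0. Qed.

Lemma inversions0r (A : {set 'I_n}) : inversions A set0 = 0%N.
Proof. by rewrite /inversions big1 // => a _; apply: eq_card0 => b; rewrite !inE. Qed.

Lemma subUD (A B : {set 'I_n}) : A \subset B -> A :|: (B :\: A) = B.
Proof.
move/subsetP=> AB; apply/setP=> x; rewrite !inE.
by case: (boolP (x \in A)) => //= /AB ->.
Qed.

Lemma omega_mulA : associative omega_mul.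
Proof.
move=> f g h; apply/ffunP=> U; rewrite !ffunE.
under [RHS]eq_bigr => B BU.
  rewrite ffunE mulr_suml mulr_sumr; over.
rewrite (exchange_big_dep (fun A : {set 'I_n} => A \subset U)) /=; last first.
  by move=> B A BU AB; apply: subset_trans AB BU.
apply: eq_bigr => A AU.
rewrite ffunE !mulr_sumr.
rewrite [RHS](reindex_onto (fun C => A :|: C) (fun B => B :\: A)) /=; last first.
  by move=> B /andP[_ AB]; apply: subUD.
have CUE (C : {set 'I_n}) : (C \subset U :\: A) =
   [&& A :|: C \subset U, A \subset A :|: C & (A :|: C) :\: A == C].
  rewrite subsetUl subUset AU subsetD setDUl setDv set0U /=.
  by rewrite (sameP eqP setDidPl).
apply: eq_big => [C|C CUA]; first by rewrite CUE andbA.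
have := CUA; rewrite CUE => /and3P[_ _ /eqP ->].
have dAC : [disjoint A & C].
  by move: CUA; rewrite subsetD disjoint_sym => /andP[].
have -> : U :\: (A :|: C) = (U :\: A) :\: C by rewrite setDDl.
have {1}-> : U :\: A = C :|: (U :\: A) :\: C.
  by apply/esym/subUD; move: CUA.
rewrite inversions_setUl // inversions_setUr; last first.
  by rewrite -setI_eq0; apply/eqP/setP=> x; rewrite !inE; case: (x \in C).
rewrite !exprD.
set a := _ ^+ _; set b := _ ^+ _; set c := _ ^+ _.
by rewrite -!mulrA [LHS]mulrCA (mulrCA (f A)) (mulrCA a c).
Qed.

Lemma omega_mul1l : left_id omega_one omega_mul.
Proof.
move=> f; apply/ffunP=> U; rewrite ffunE (bigD1 set0) ?sub0set //=.
rewrite ffunE eqxx mul1r setD0 inversions0l mul1r big1 ?addr0 //.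
by move=> A /andP[_ /negbTE nA]; rewrite ffunE nA mul0r mulr0.
Qed.

Lemma omega_mul1r : right_id omega_one omega_mul.
Proof.
move=> f; apply/ffunP=> U; rewrite ffunE (bigD1 U) //=.
rewrite ffunE setDv eqxx mulr1 inversions0r mul1r big1 ?addr0 //.
move=> A /andP[AU nA]; rewrite ffunE setD_eq0.
suff /negbTE-> : ~~ (U \subset A) by rewrite !mulr0.
by apply: contra nA => UA; rewrite eqEsubset AU.
Qed.

Lemma omega_mulDl : left_distributive omega_mul +%R.
Proof.
move=> f g h; apply/ffunP=> U; rewrite !ffunE -big_split /=.
by apply: eq_bigr => A _; rewrite ffunE mulrDl mulrDr.
Qed.

Lemma omega_mulDr : right_distributive omega_mul +%R.
Proof.
move=> f g h; apply/ffunP=> U; rewrite !ffunE -big_split /=.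
by apply: eq_bigr => A _; rewrite ffunE mulrDr mulrDr.
Qed.

Lemma omega_one_neq0 : omega_one != 0.
Proof.
by apply/eqP=> /ffunP /(_ set0); rewrite !ffunE eqxx => /eqP; rewrite oner_eq0.
Qed.

HB.instance Definition _ := GRing.Zmodule_isNzRing.Build Om
  omega_mulA omega_mul1l omega_mul1r omega_mulDl omega_mulDr omega_one_neq0.

Lemma omega_scaleAl (c : K) (f g : Om) : c *: (f * g) = (c *: f) * g.
Proof.
apply/ffunP=> U; rewrite !ffunE scaler_sumr; apply: eq_bigr => A _.
by rewrite ffunE -scalerAl -scalerAr.
Qed.

HB.instance Definition _ := GRing.Lmodule_isLalgebra.Build K Om omega_scaleAl.

Lemma omega_scaleAr (c : K) (f g : Om) : c *: (f * g) = f * (c *: g).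
Proof.
apply/ffunP=> U; rewrite !ffunE scaler_sumr; apply: eq_bigr => A _.
by rewrite ffunE -scalerAr -scalerAr.
Qed.

HB.instance Definition _ := GRing.Lalgebra_isAlgebra.Build K Om omega_scaleAr.

Definition ofS (p : {mpoly K[n]}) : Om :=
  [ffun U : {set 'I_n} => if U == set0 then p else 0].

Definition theta (i : 'I_n) : Om := [ffun U : {set 'I_n} => (U == [set i])%:R].

Lemma ofS_mull (p : {mpoly K[n]}) (f : Om) : ofS p * f = [ffun U => p * f U].
Proof.
apply/ffunP=> U; rewrite !ffunE (bigD1 set0) ?sub0set //=.
rewrite ffunE eqxx setD0 inversions0l mul1r big1 ?addr0 //.
by move=> A /andP[_ /negbTE nA]; rewrite ffunE nA mul0r mulr0.
Qed.

Lemma ofS_comm (p : {mpoly K[n]}) (f : Om) : f * ofS p = ofS p * f.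
Proof.
rewrite ofS_mull; apply/ffunP=> U; rewrite !ffunE (bigD1 U) //=.
rewrite ffunE setDv eqxx inversions0r mul1r mulrC big1 ?addr0 //.
move=> A /andP[AU nA]; rewrite ffunE setD_eq0.
suff /negbTE-> : ~~ (U \subset A) by rewrite !mulr0.
by apply: contra nA => UA; rewrite eqEsubset AU.
Qed.

Lemma theta_mull (i : 'I_n) (f : Om) :
  theta i * f = [ffun U : {set 'I_n} => if i \in U then
     (-1) ^+ #|[set j in U | (j < i)%N]| * f (U :\ i) else 0].
Proof.
apply/ffunP=> U; rewrite !ffunE; case: ifPn => iU; last first.
  rewrite big1 // => A AU; rewrite ffunE.
  case: eqP => [A_i|_]; last by rewrite mul0r mulr0.
  by case/negP: iU; rewrite -sub1set -A_i.
rewrite (bigD1 [set i]) ?sub1set //= ffunE eqxx mul1r big1 ?addr0; last first.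
  by move=> A /andP[_ /negbTE nA]; rewrite ffunE nA mul0r mulr0.
congr (_ ^+ _ * _); rewrite /inversions big_set1; apply: eq_card => j.
by rewrite !inE; case: eqP => // ->; rewrite ltnn !andbF.
Qed.

Lemma theta_sq (i : 'I_n) : theta i * theta i = 0.
Proof.
rewrite theta_mull; apply/ffunP=> U; rewrite !ffunE; case: ifP => // iU.
suff /negbTE-> : U :\ i != [set i] by rewrite mulr0.
by apply/eqP=> /setP/(_ i); rewrite !inE eqxx.
Qed.

Lemma theta_anticomm (i j : 'I_n) : theta i * theta j = - (theta j * theta i).
Proof.
have [->|nij] := eqVneq i j; first by rewrite theta_sq oppr0.
have cardP (a b : 'I_n) : a != b ->
    #|[set c in [set a; b] | (c < a)%N]| = (b < a)%N.
  move=> nab; rewrite (_ : [set c in _ | _] = if (b < a)%N then [set b] else set0).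
    by case: ifP; rewrite ?cards1 ?cards0.
  apply/setP=> c; rewrite !inE; have [->|nca] /= := eqVneq c a.
    by rewrite ltnn; case: ifP; rewrite !inE ?(negbTE nab).
  by have [->|ncb] /= := eqVneq c b; case: ifP; rewrite !inE ?eqxx // (negbTE ncb).
have E (a b : 'I_n) : a != b -> theta a * theta b =
   [ffun U : {set 'I_n} => if U == [set a; b] then (-1) ^+ (b < a)%N else 0] :> Om.
  move=> nab; rewrite theta_mull; apply/ffunP=> U; rewrite !ffunE.
  case: (eqVneq U [set a; b]) => [->|nU].
    rewrite !inE eqxx /= cardP // (_ : _ == _) ?mulr1 //.
    by apply/eqP/setP=> c; rewrite !inE; case: (eqVneq c a) => // ->; rewrite (negbTE nab).
  case: ifP => // aU; case: eqP => [Ub|_]; last by rewrite mulr0.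
  by case/eqP: nU; rewrite -(setD1K aU) Ub.
rewrite E // E 1?eq_sym //; apply/ffunP=> U; rewrite !ffunE setUC.
case: ifP => _; last by rewrite oppr0.
case: ltngtP => [_|_|/val_inj ij]; rewrite /= ?expr0 ?expr1 ?opprK //.
by rewrite ij eqxx in nij.
Qed.

End OmegaAlgebra.

Section InverseSystem.
Variables (K : fieldType) (n : nat).
Local Notation Om := (Omega K n).

Definition dx (i : 'I_n) (f : Om) : Om := [ffun U => (f U)^`M(i)].

(* The coefficient of theta_U comes from theta_(i |: U), in which theta_i is
   preceded by the theta_j with j in U and j < i. *)
Definition dtheta (i : 'I_n) (f : Om) : Om :=
  [ffun U : {set 'I_n} => if i \in U then 0
     else (-1) ^+ #|[set j in U | (j < i)%N]| * f (i |: U)].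

(* [enum A] is increasing, so that theta_A = theta_a1 * ... * theta_ak becomes
   the composite dtheta a1 \o ... \o dtheta ak. *)
Definition dthetas (A : {set 'I_n}) (g : Om) : Om := foldr dtheta g (enum A).

Definition dxs (m : 'X_{1..n}) (g : Om) : Om := [ffun U => (g U)^`M[m]].

Definition odot (f g : Om) : Om :=
  \sum_(A : {set 'I_n}) \sum_(m <- msupp (f A))
     (f A)@_m *: dxs m (dthetas A g).

Definition inverse_system (I : Om -> Prop) (g : Om) : Prop :=
  forall f, I f -> odot f g = 0.

Definition euler (j : nat) (f : Om) : Om :=
  \sum_(i < n) iter j (dx i) f * theta K i.

Definition is_subspace (W : Om -> Prop) : Prop :=
  W 0 /\ forall (c : K) (f g : Om), W f -> W g -> W (c *: f + g).

Definition is_ideal (I : Om -> Prop) : Prop :=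
  [/\ I 0, forall f g, I f -> I g -> I (f + g) &
      forall a f b, I f -> I (a * f * b)].

Definition ideal_generated (G : Om -> Prop) (f : Om) : Prop :=
  forall I : Om -> Prop, is_ideal I -> (forall g, G g -> I g) -> I f.

Definition wreath (r : nat) (A : 'M[K]_n) : Prop :=
  [/\ forall i, exists! j, A i j != 0,
      forall j, exists! i, A i j != 0 &
      forall i j, A i j != 0 -> A i j ^+ r = 1].

(* A monomial matrix A whose nonzero entry in column i is a, in row j, sends
   x_i to a^-1 x_j and theta_i to a^-1 theta_j; the other entries of the column
   contribute nothing below because 0^-1 = 0. *)
Definition act_x (A : 'M[K]_n) (i : 'I_n) : {mpoly K[n]} :=
  \sum_j (A j i)^-1 *: 'X_j.

Definition act_theta (A : 'M[K]_n) (i : 'I_n) : Om :=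
  \sum_j (A j i)^-1 *: theta K j.

(* The noncommutative product over i in U is taken in increasing order. *)
Definition act (A : 'M[K]_n) (f : Om) : Om :=
  \sum_(U : {set 'I_n})
     ofS (f U \mPo [tuple act_x A i | i < n]) * \prod_(i in U) act_theta A i.

Definition invariant (r : nat) (f : Om) : Prop :=
  forall A, wreath r A -> act A f = f.

Definition SI (r : nat) : Om -> Prop :=
  ideal_generated (fun f => invariant r f /\ (f set0)@_0%MM = 0).

Definition delta (r : nat) : {mpoly K[n]} :=
  (\prod_(i < n) 'X_i) ^+ r.-1 *
  \prod_(i < n) \prod_(j < n | (i < j)%N) ('X_i ^+ r - 'X_j ^+ r).

Definition operator_closed (r : nat) (W : Om -> Prop) : Prop :=
  [/\ is_subspace W,
      W (ofS (delta r)),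
      forall i f, W f -> W (dx i f) &
      forall k f, (k < n)%N -> W f -> W (euler (k * r + 1)%N f)].

Lemma dtheta_theta (i : 'I_n) (f : Om) :
  dtheta i (theta K i * f) + theta K i * dtheta i f = f.
Proof.
apply/ffunP=> U; rewrite theta_mull theta_mull !ffunE.
have sq1 m : (-1) ^+ m * (-1) ^+ m = 1 :> {mpoly K[n]}.
  by rewrite -exprD addnn -mul2n exprM sqrrN !expr1n.
have [iU|iU] := ifP.
  rewrite add0r setD11 setD1K // mulrA.
  rewrite (_ : [set j in U :\ i | _] = [set j in U | (j < i)%N]) ?sq1 ?mul1r //.
  by apply/setP=> j; rewrite !inE; case: eqP => // ->; rewrite ltnn !andbF.
rewrite addr0 setU11 setU1K ?iU // mulrA.
rewrite (_ : [set j in i |: U | _] = [set j in U | (j < i)%N]) ?sq1 ?mul1r //.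
by apply/setP=> j; rewrite !inE; case: eqP => // ->; rewrite ltnn !andbF.
Qed.

Lemma theta_prod (U : {set 'I_n}) :
  \prod_(i in U) theta K i = [ffun V : {set 'I_n} => (V == U)%:R] :> Om.
Proof.
have gen (s : seq 'I_n) : sorted ltn (map val s) ->
    \prod_(i <- s) theta K i = [ffun V : {set 'I_n} => (V == [set x in s])%:R] :> Om.
  elim: s => [_|a s IHs /= as_path].
    by rewrite big_nil; apply/ffunP=> V; rewrite !ffunE.
  rewrite big_cons IHs ?(path_sorted as_path) // theta_mull.
  have gta j : j \in s -> (a < j)%N.
    move=> js; have /allP := order_path_min ltn_trans as_path.
    by apply; apply: map_f.
  apply/ffunP=> V; rewrite !ffunE (_ : [set x in a :: s] = a |: [set x in s]); last first.
    by apply/setP=> x; rewrite !inE.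
  have [->|nV] := eqVneq V (a |: [set x in s]).
    rewrite setU11 setU1K ?eqxx ?mulr1; last first.
      by rewrite inE; apply/negP => /gta; rewrite ltnn.
    rewrite (_ : [set j in _ | _] = set0) ?cards0 //; apply/setP=> j; rewrite !inE.
    by case: eqVneq => [->|_] /=; [rewrite ltnn | apply/negP => /andP[/gta /ltnW]; rewrite leqNgt => /negP].
  case: ifP => // aV; case: eqP => [Vs|_]; last by rewrite mulr0.
  by rewrite -Vs setD1K ?eqxx in nV.
rewrite -big_filter gen.
  apply/ffunP=> V; rewrite !ffunE; congr ((_ == _)%:R); apply/setP=> i.
  by rewrite inE mem_filter mem_index_enum andbT.
apply: (subseq_sorted ltn_trans (s2 := map val (enum 'I_n))).
  by rewrite [index_enum _]unlock -enumT map_subseq ?filter_subseq.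
by rewrite val_enum_ord iota_ltn_sorted.
Qed.

Lemma act_ofS (A : 'M[K]_n) (p : {mpoly K[n]}) :
  act A (ofS p) = ofS (p \mPo [tuple act_x A i | i < n]).
Proof.
rewrite /act (bigD1 set0) //= big_set0 mulr1 ffunE eqxx big1 ?addr0 // => U.
move=> /negbTE nU; rewrite ffunE nU comp_mpoly0 ofS_mull.
by apply/ffunP=> V; rewrite !ffunE mul0r.
Qed.

Lemma act_thetaE (A : 'M[K]_n) (i : 'I_n) : act A (theta K i) = act_theta A i.
Proof.
rewrite /act (bigD1 [set i]) //= big_set1 ffunE eqxx big1 ?addr0 => [|U].
  by rewrite comp_mpoly1 ofS_mull; apply/ffunP=> V; rewrite !ffunE mul1r.
move=> /negbTE nU; rewrite ffunE nU comp_mpoly0 ofS_mull.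
by apply/ffunP=> V; rewrite !ffunE mul0r.
Qed.

Lemma act_x_diag (d : 'rV[K]_n) (i : 'I_n) :
  act_x (diag_mx d) i = (d 0 i)^-1 *: 'X_i.
Proof.
rewrite /act_x (bigD1 i) //= big1 ?addr0 ?mxE ?eqxx ?mulr1n // => j nji.
by rewrite mxE (negbTE nji) mulr0n invr0 scale0r.
Qed.

Lemma act_x_perm (A : 'M[K]_n) (w : {perm 'I_n}) (i : 'I_n) :
  (forall j k, A j k = (j == w k)%:R) -> act_x A i = 'X_(w i).
Proof.
move=> Aw; rewrite /act_x (bigD1 (w i)) //= big1 ?addr0 ?Aw ?eqxx ?invr1 ?scale1r // => j nji.
by rewrite Aw (negbTE nji) invr0 scale0r.
Qed.

End InverseSystem.

(* Main.v *)
(* Let polynomials act on polynomials by differentiation, and order the subsets J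
   of {0, ..., n-1} by the sum of their elements.  If J is maximal with g_J <> 0
   for an element g of the inverse system, then g_J is annihilated by the power
   sums in the x_i^r and, because g is annihilated by their differentials, by
     x_j^(r-1) prod_(l < j, l notin J) (x_j^r - x_l^r)   for all j in J.
   On the other hand, combining the Euler operators with coefficients in the
   derivatives yields from delta an element whose last nonzero component is the
   J-component, where it equals the image of delta under
     f_J = prod_(j in J) x_j prod_(t > j) (x_j^r - x_t^r).
   So it suffices that every polynomial annihilated by those operators is a
   derivative of the image of delta under f_J.

   This is linkage of complete intersections, carried out on the dual side, where
   a regular sequence becomes a sequence of differential operators each of which
   is surjective on the common kernel of the preceding ones.  On the kernel of
   the lower power sums, the next power sum is a product of linear forms
   x_j - z x_t with z = 0 or z^r = 1; on the kernel of such a form there is one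
   independent variable less, whence all the surjectivity statements by
   induction. *)

From HB Require Import structures.
Require Import Defs.
From mathcomp Require Import all_boot all_order fingroup perm all_algebra.
From mathcomp Require Import cyclic separable cyclotomic mpoly.

Set Implicit Arguments.
Unset Strict Implicit.
Unset Printing Implicit Defensive.

Import GRing.Theory.
Local Open Scope ring_scope.

(** * Coregular sequences of differential operators *)

Section DifferentialAction.
Variables (K : fieldType) (n : nat).
Local Notation S := {mpoly K[n]}.
Implicit Types (a b f g : S) (m : 'X_{1..n}).

Definition pd a f : S := \sum_(m <- msupp a) a@_m *: f^`M[m].

Lemma pd_finsum a (s : seq 'X_{1..n}) f : uniq s -> {subset msupp a <= s} ->
  pd a f = \sum_(m <- s) a@_m *: f^`M[m].
Proof.
move=> us sub; rewrite /pd (bigID (mem (msupp a)) predT) /= addrC.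
rewrite [in RHS](bigID (mem (msupp a))) /= [X in _ = _ + X]big1 ?addr0; last first.
  by move=> m /memN_msupp_eq0 ->; rewrite scale0r.
rewrite big_seq_cond big1 ?add0r; last by move=> m /andP[->].
rewrite -[LHS]big_filter -[RHS]big_filter; apply/perm_big/uniq_perm.
- by rewrite filter_uniq ?msupp_uniq.
- by rewrite filter_uniq.
- by move=> m; rewrite !mem_filter; case: (boolP (m \in msupp a)) => //= /sub.
Qed.

Lemma pd_is_linear a : linear (pd a).
Proof.
move=> c f g; rewrite /pd scaler_sumr -big_split /=; apply: eq_bigr => m _.
by rewrite linearP scalerDr !scalerA mulrC.
Qed.

HB.instance Definition _ a := GRing.isLinear.Build K S S _ (pd a) (pd_is_linear a).

Lemma pdDl a b f : pd (a + b) f = pd a f + pd b f.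
Proof.
pose s := undup (msupp a ++ msupp b).
rewrite !(@pd_finsum _ s) ?undup_uniq //.
- by rewrite -big_split; apply: eq_bigr => m _; rewrite mcoeffD scalerDl.
- by move=> m; rewrite mem_undup mem_cat => ->; rewrite orbT.
- by move=> m; rewrite mem_undup mem_cat => ->.
- by move=> m /msuppD_le; rewrite mem_undup.
Qed.

Lemma pdZl c a f : pd (c *: a) f = c *: pd a f.
Proof.
rewrite (@pd_finsum _ (msupp a)) ?msupp_uniq //; last exact: msuppZ_le.
by rewrite scaler_sumr; apply: eq_bigr => m _; rewrite mcoeffZ scalerA.
Qed.

Lemma pd0l f : pd 0 f = 0.
Proof. by have := pdZl 0 0 f; rewrite !scale0r. Qed.

Lemma pdBl a b f : pd (a - b) f = pd a f - pd b f.
Proof. by rewrite pdDl -scaleN1r pdZl scaleN1r. Qed.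

Lemma pd_suml I (s : seq I) (P : pred I) (F : I -> S) f :
  pd (\sum_(i <- s | P i) F i) f = \sum_(i <- s | P i) pd (F i) f.
Proof. exact: (big_morph (pd^~ f) (fun a b => pdDl a b f) (pd0l f)). Qed.

Lemma pdXm m f : pd 'X_[m] f = f^`M[m].
Proof. by rewrite /pd msuppX big_seq1 mcoeffX eqxx scale1r. Qed.

Lemma pdX i f : pd 'X_i f = f^`M(i).
Proof. by rewrite pdXm mderivmU1m. Qed.

Lemma pd1l f : pd 1 f = f.
Proof. by rewrite -mpolyX0 pdXm mderivm0m. Qed.

Lemma pdMl a b f : pd (a * b) f = pd a (pd b f).
Proof.
rewrite (mpolyE a) mulr_suml !pd_suml; apply: eq_bigr => m _.
rewrite -scalerAl !pdZl pdXm; congr (_ *: _).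
rewrite (mpolyE b) mulr_sumr !pd_suml linear_sum; apply: eq_bigr => k _.
rewrite -scalerAr -mpolyXD !pdZl !pdXm linearZ /=; congr (_ *: _).
by rewrite addmC mderivmDm.
Qed.

Lemma pdC a b f : pd a (pd b f) = pd b (pd a f).
Proof. by rewrite -!pdMl mulrC. Qed.

Lemma pd_mderiv a i f : pd a f^`M(i) = (pd a f)^`M(i).
Proof. by rewrite -!pdX pdC. Qed.

End DifferentialAction.

Section Coregular.
Variables (K : fieldType) (n : nat).
Local Notation S := {mpoly K[n]}.
Implicit Types (a b f g : S) (s : seq S) (V : S -> Prop).

Definition submod V :=
  [/\ V 0, forall f g, V f -> V g -> V (f - g) & forall a f, V f -> V (pd a f)].

Definition pker V a f := V f /\ pd a f = 0.

Definition pkers V s := foldl pker V s.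

Definition cosurj V a := forall f, V f -> exists2 g, V g & pd a g = f.

Fixpoint coreg V s :=
  if s is a :: s' then cosurj V a /\ coreg (pker V a) s' else True.

Definition lowering a := forall f, (msize (pd a f) <= (msize f).-1)%N.

Lemma submodD V f g : submod V -> V f -> V g -> V (f + g).
Proof.
case=> V0 VB _ Vf Vg; rewrite -[g]opprK -[- g]sub0r.
by apply: (VB _ _ Vf); apply: VB.
Qed.

Lemma submodZ V c f : submod V -> V f -> V (c *: f).
Proof. by case=> _ _ Vpd Vf; rewrite -[f]pd1l -pdZl; apply: Vpd. Qed.

Lemma submod_sum V (I : Type) (r : seq I) (P : pred I) (F : I -> S) :
  submod V -> (forall i, P i -> V (F i)) -> V (\sum_(i <- r | P i) F i).
Proof.
move=> sV VF; elim/big_rec: _ => [|i f Pi Vf]; first by case: sV.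
by apply: submodD => //; apply: VF.
Qed.

Lemma submod_pker V a : submod V -> submod (pker V a).
Proof.
move=> [V0 VB Vpd]; split; first by split; rewrite ?linear0.
- move=> f g [Vf af] [Vg ag]; split; first exact: VB.
  by rewrite linearB /= af ag subrr.
- by move=> b f [Vf af]; split; [exact: Vpd|rewrite pdC af linear0].
Qed.

Lemma pkersP V s f : pkers V s f <-> V f /\ forall a, a \in s -> pd a f = 0.
Proof.
elim: s V => [|a s IHs] V /=; first by split=> [|[]].
rewrite IHs; split=> [[[Vf af] sf]|[Vf sf]].
  by split=> // b; rewrite inE => /predU1P[->|/sf].
split; first by split=> //; apply: sf; rewrite mem_head.
by move=> b bs; apply: sf; rewrite inE bs orbT.
Qed.

Lemma submod_pkers V s : submod V -> submod (pkers V s).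
Proof. by elim: s V => //= a s IHs V sV; apply/IHs/submod_pker. Qed.

Lemma cosurj_ext V V' a a' : (forall f, V f <-> V' f) ->
  (forall f, V f -> pd a f = pd a' f) -> cosurj V a -> cosurj V' a'.
Proof.
move=> eV ea ca f /eV/ca[g Vg <-]; exists g; first exact/eV.
exact/esym/ea.
Qed.

Lemma coreg_ext V V' s : (forall f, V f <-> V' f) -> coreg V s -> coreg V' s.
Proof.
elim: s V V' => //= a s IHs V V' eV [ca cs]; split.
  exact: cosurj_ext eV _ ca.
by apply: IHs cs => f; rewrite /pker eV.
Qed.

Lemma coreg_rcons V s a :
  coreg V (rcons s a) <-> coreg V s /\ cosurj (pkers V s) a.
Proof. by elim: s V => [|b s IHs] V /=; [tauto | rewrite IHs; tauto]. Qed.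

Lemma pkerC V a b f : pker (pker V a) b f <-> pker (pker V b) a f.
Proof. by rewrite /pker; tauto. Qed.

(** Dual to moving an element to the end of a regular sequence. For a single [b], lift [f] from the
    kernel of [b] to [g] along [a]; then [pd b g] lies in the kernel of [a], and a lift of it along
    [b] inside that kernel corrects [g]. *)
Lemma coreg_exchange V a s : submod V -> cosurj V a -> coreg (pker V a) s ->
  cosurj (pkers V s) a.
Proof.
elim: s V => //= b s IHs V sV ca [cb cs]; have [_ VB Vpd] := sV.
apply: IHs; first exact: submod_pker.
  move=> f [Vf bf]; have [g Vg ag] := ca f Vf.
  have [|h [Vh ah] bh] := cb (pd b g).
    by split; [exact: Vpd | rewrite pdC ag].
  exists (g - h); last by rewrite linearB /= ag ah subr0.
  by split; [exact: VB | rewrite linearB /= bh subrr].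
by apply: coreg_ext cs => f; apply: pkerC.
Qed.

(* A lift of f along b is built by lifting pd a f first, which has smaller
   degree. *)
Lemma coreg_drop V a s : submod V -> lowering a -> cosurj V a ->
  coreg (pker V a) s -> coreg V s.
Proof.
move=> + la; elim: s V => //= b s IHs V sV ca [cb cs].
have [V0 VB Vpd] := sV; split.
  move=> f; elim: {f}(msize f) {-2}f (leqnn (msize f)) => [|k IHk] f.
    rewrite leqn0 msize_poly_eq0 => /eqP-> _.
    by exists 0; rewrite ?linear0.
  move=> szf Vf; have [||g Vg bg] := IHk (pd a f); [|exact: Vpd|].
    by apply: leq_trans (la f) _; case: (msize f) szf.
  have [g' Vg' ag'] := ca g Vg.
  have [|h [Vh ah] bh] := cb (f - pd b g').
    split; first by apply: VB => //; apply: Vpd.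
    by rewrite linearB /= pdC ag' bg subrr.
  exists (g' + h); first exact: submodD.
  by rewrite linearD /= bh addrC subrK.
apply: IHs; first exact: submod_pker.
  by have /= := @coreg_exchange V a [:: b] sV ca (conj cb I).
by apply: coreg_ext cs => f; apply: pkerC.
Qed.

Lemma cosurjM V a b : cosurj V a -> cosurj V b -> cosurj V (a * b).
Proof.
move=> ca cb f /ca[g /cb[h Vh <-] <-]; exists h => //; exact: pdMl.
Qed.

(** The operator [pd a] maps the kernel of [a * b] onto the kernel of [b], with the kernel of [a] as
    its kernel. Surjectivity on the outer terms of this exact sequence gives it in the middle, and
    exchange carries the hypotheses over to the kernel of [p]. *)
Lemma coreg_mul V a b s : submod V -> cosurj V a -> cosurj V b ->
  coreg (pker V a) s -> coreg (pker V b) s -> coreg (pker V (a * b)) s.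
Proof.
elim: s V => //= p s IHs V sV ca cb [cap cas] [cbp cbs].
have [V0 VB Vpd] := sV; split.
  move=> f [Vf abf].
  have [|g [Vg bg] pg] := cbp (pd a f).
    by split; [exact: Vpd | rewrite -pdMl mulrC].
  have [g' Vg' ag'] := ca g Vg.
  have [|h [Vh ah] ph] := cap (f - pd p g').
    split; first by apply: VB => //; apply: Vpd.
    by rewrite linearB /= pdC ag' pg subrr.
  exists (g' + h); last by rewrite linearD /= ph addrC subrK.
  split; first exact: submodD.
  by rewrite linearD /= mulrC pdMl ag' bg add0r pdMl ah linear0.
have e := coreg_ext (fun f => pkerC V _ _ f).
apply: (coreg_ext (V := pker (pker V p) (a * b))).
  by move=> f; apply: pkerC.
apply: IHs; first exact: submod_pker.
- exact: (coreg_exchange (s := [:: p]) sV ca (conj cap I)).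
- exact: (coreg_exchange (s := [:: p]) sV cb (conj cbp I)).
- exact: e cas.
- exact: e cbs.
Qed.

Lemma coreg0 s : coreg (fun f => f = 0) s.
Proof.
elim: s => //= a s IHs; split=> [f ->|]; first by exists 0; rewrite ?linear0.
apply: coreg_ext IHs => f; split=> [->|[]//]; by split; rewrite ?linear0.
Qed.

Lemma coreg_prod V (ls s : seq S) : submod V ->
    (forall l, l \in ls -> coreg V (l :: s)) ->
  coreg V (\prod_(l <- ls) l :: s).
Proof.
move=> sV; elim: ls => [|l ls IHls] cls.
  (* The empty product is 1, whose kernel is zero. *)
  rewrite big_nil; split=> [f Vf|]; first by exists f; rewrite ?pd1l.
  apply: coreg_ext (coreg0 s) => f; split=> [->|[_]]; last by rewrite pd1l.
  by split; rewrite ?linear0 //; case: sV.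
rewrite big_cons; have [cl cs] := cls l (mem_head _ _).
have [x lsx|cls' css] := IHls; first by apply: cls; rewrite inE lsx orbT.
by split; [exact: cosurjM | exact: coreg_mul].
Qed.

Lemma cosurj_prod V (ls : seq S) : submod V ->
  (forall l, l \in ls -> cosurj V l) -> cosurj V (\prod_(l <- ls) l).
Proof.
move=> sV cls; have [|//] := @coreg_prod V ls [::] sV.
by move=> l /cls.
Qed.

End Coregular.

(** * Splitting differences of r-th powers into linear factors *)

Section Homogenization.
Variables (K : closedFieldType) (S : comAlgType K).

(** Homogenization of a univariate product, by which the factorization of X^r - 1 over K transfers
    to [x ^+ r - y ^+ r]. *)
Lemma prod_sub_scaleE (zs : seq K) (x y : S) :
  \prod_(z <- zs) (x - z *: y) =
  \sum_(i < (size zs).+1)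
     (\prod_(z <- zs) ('X - z%:P))`_i *: (x ^+ i * y ^+ (size zs - i)).
Proof.
elim: zs => [|z zs IHzs] /=.
  by rewrite !big_nil big_ord1 coef1 expr0 mulr1 scale1r.
rewrite !big_cons IHzs; set p := \prod_(w <- zs) _.
have sp : size p = (size zs).+1 by rewrite /p size_prod_XsubC.
rewrite (eq_bigr (fun i : 'I_(size zs).+2 =>
    ('X * p)`_i *: (x ^+ i * y ^+ ((size zs).+1 - i))
    - (z *: p)`_i *: (x ^+ i * y ^+ ((size zs).+1 - i)))); last first.
  by move=> i _; rewrite mulrBl coefB scalerBl mul_polyC.
rewrite sumrB mulrBl; congr (_ - _).
  rewrite [RHS]big_ord_recl coefXM scale0r add0r mulr_sumr; apply: eq_bigr => i _.
  by rewrite coefXM /= subSS exprS -mulrA -scalerAr.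
rewrite [RHS]big_ord_recr /= coefZ nth_default ?sp // mulr0 scale0r addr0 mulr_sumr.
apply: eq_bigr => i _; rewrite coefZ subSn ?leq_ord // exprS.
by rewrite -scalerAl -scalerAr scalerA mulrCA.
Qed.

Lemma subXX_factor r : (0 < r)%N -> exists2 zs : seq K,
  all (fun z => z ^+ r == 1) zs &
  forall x y : S, x ^+ r - y ^+ r = \prod_(z <- zs) (x - z *: y).
Proof.
move=> r_gt0; have [zs Dp] := closed_field_poly_normal ('X^r - 1 : {poly K}).
have mon : ('X^r - 1 : {poly K}) \is monic by rewrite monicXnsubC.
rewrite (monicP mon) scale1r in Dp.
have szs : size zs = r.
  by have := size_prod_XsubC zs id; rewrite -Dp size_XnsubC // => -[].
exists zs.
  apply/allP=> z zzs; have : root ('X^r - 1) z by rewrite Dp root_prod_XsubC.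
  by rewrite /root !hornerE subr_eq0.
move=> x y; rewrite prod_sub_scaleE -Dp szs.
under eq_bigr do rewrite coefB coefXn coef1 scalerBl.
rewrite sumrB big_ord_recr /= eqxx scale1r subnn expr0 mulr1 big1 ?add0r.
  rewrite big_ord_recl /= scale1r expr0 mul1r subn0 big1 ?addr0 // => i _.
  by rewrite scale0r.
by move=> i _; rewrite ltn_eqF ?scale0r.
Qed.

End Homogenization.

(** * Power sums in the r-th powers of the variables *)

Section PowerSums.
Variables (K : fieldType) (n r : nat).
Local Notation S := {mpoly K[n]}.
Local Notation y i := ('X_i ^+ r : S).

Definition pw k : S := \sum_(i < n) y i ^+ k.

(** The operators commute, so two that agree on [f] may be exchanged one factor at a time in every
    power. *)
Lemma pd_horner (p : {poly S}) (u v f : S) :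
  pd u f = pd v f -> pd p.[u] f = pd p.[v] f.
Proof.
move=> uv; rewrite !horner_coef !pd_suml; apply: eq_bigr => k _.
rewrite !pdMl; congr (pd _ _); elim: {k}(k : nat) => [|k IHk]; first by rewrite !expr0.
by rewrite exprSr pdMl uv pdC IHk -pdMl -exprS.
Qed.

(* The values at the y_i of a monic polynomial of degree m+1 without constant
   term add up to pw m.+1 plus a combination of pw 1, ..., pw m. *)
Lemma pd_pwS (B : {set 'I_n}) f : (forall s, (0 < s <= #|B|)%N -> pd (pw s) f = 0) ->
  pd (pw #|B|.+1) f = \sum_i pd (y i * \prod_(t in B) (y i - y t)) f.
Proof.
move=> pf; pose p : {poly S} := 'X * \prod_(t in B) ('X - (y t)%:P).
have mq : \prod_(t in B) ('X - (y t)%:P) \is monic by apply: monic_prod_XsubC.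
have szp : size p = #|B|.+2.
  rewrite /p mulrC size_mulX ?monic_neq0 //.
  by rewrite -big_enum /= size_prod_XsubC -cardE.
have p0 : p`_0 = 0 by rewrite coefXM.
have pE i : p.[y i] = y i * \prod_(t in B) (y i - y t).
  by rewrite hornerM hornerX horner_prod; congr (_ * _); apply: eq_bigr => t _; rewrite !hornerE.
under eq_bigr do rewrite -pE horner_coef szp.
rewrite -pd_suml exchange_big big_ord_recr big_ord_recl /= !pdDl.
rewrite [X in _ = pd X f + _ + _]big1 => [|i _]; last by rewrite p0 mul0r.
rewrite pd0l add0r [X in _ = X + _](_ : _ = 0) ?add0r; last first.
  rewrite pd_suml big1 // => s _.
  by rewrite -mulr_sumr pdMl -/(pw _) pf ?linear0 //= lift0 /= ltn_ord.
suff -> : p`_(#|B|.+1) = 1 by rewrite -mulr_sumr mul1r.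
have mp : p \is monic by rewrite /p monicMr ?monicX.
by move/monicP: mp; rewrite lead_coefE szp.
Qed.

End PowerSums.

(** * Regularity of power sums *)

Section Configurations.
Variables (K : numClosedFieldType) (n r : nat).
Hypothesis r_gt0 : (0 < r)%N.
Local Notation S := {mpoly K[n]}.
Implicit Types (f g : S) (T A : {set 'I_n}) (z : K) (c : 'I_n -> K) (h : 'I_n -> 'I_n).

Definition lin (i : 'I_n) z (t : 'I_n) : S := 'X_i - z *: 'X_t.

Lemma pd_lin i z t f : pd (lin i z t) f = f^`M(i) - z *: f^`M(t).
Proof. by rewrite pdBl pdZl !pdX. Qed.

Lemma msize_mderiv i f : (msize f^`M(i) <= (msize f).-1)%N.
Proof.
rewrite msizeE; apply/bigmax_leqP_seq => m; rewrite mcoeff_msupp mcoeff_mderiv => fm _.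
suff: (mdeg (m + U_(i)) < msize f)%N.
  by rewrite mdegD mdeg1 addn1; case: (msize f).
apply: msize_mdeg_lt; rewrite mcoeff_msupp.
by apply: contraNneq fm => ->; rewrite mul0rn.
Qed.

Lemma lowering_lin i z t : lowering (lin i z t).
Proof.
move=> f; rewrite pd_lin -scaleNr; apply: leq_trans (msizeD_le _ _) _.
rewrite geq_max msize_mderiv (leq_trans (msizeZ_le _ _)) //.
exact: msize_mderiv.
Qed.

(* Polynomials on which each d/dx_i acts as c i times d/dx_(h i), where the
   variables x_t with t in T are independent. *)
Definition cfgV c h f := forall i, f^`M(i) = c i *: f^`M(h i).

Definition config T c h :=
  (forall t, t \in T -> c t = 1 /\ h t = t) /\
  (forall i, c i = 0 \/ c i ^+ r = 1 /\ h i \in T).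

(** The forms [lin i z t] with valid [z] and [t] include the linear factors of x_i^r (z = 0,
    whatever t is) and of x_i^r - x_t^r with t in A. *)
Definition valid A z (t : 'I_n) := z = 0 \/ z ^+ r = 1 /\ t \in A.

Lemma submod_cfgV c h : submod (cfgV c h).
Proof.
split=> [i|f g Vf Vg i|a f Vf i]; first by rewrite !linear0 ?scaler0.
  by rewrite !mderivB Vf Vg -scalerBr.
by rewrite -!pd_mderiv Vf linearZ.
Qed.

Lemma cfgV_pd c h f i k : cfgV c h f ->
  pd ('X_i ^+ k) f = c i ^+ k *: pd ('X_(h i) ^+ k) f.
Proof.
elim: k f => [|k IHk] f Vf; first by rewrite !expr0 scale1r.
rewrite !exprSr !pdMl IHk; last by case: (submod_cfgV c h) => _ _; apply.
by rewrite -scalerA; congr (_ *: _); rewrite !pdX Vf linearZ.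
Qed.

(* Imposing in addition that d/dx_j acts as z times d/dx_t removes j from the
   independent variables. *)
Definition cfg_c c h j z i := if h i == j then c i * z else c i.
Definition cfg_h h j (t : 'I_n) i := if h i == j then t else h i.

Lemma config_step T c h j z t : config T c h -> j \in T -> valid (T :\ j) z t ->
  config (T :\ j) (cfg_c c h j z) (cfg_h h j t).
Proof.
move=> [cT ch] jT vt; rewrite /cfg_c /cfg_h; split=> [i|i].
  rewrite !inE => /andP[nij iT]; have [-> hi] := cT i iT.
  by rewrite hi (negbTE nij).
case: (eqVneq (h i) j) => [hi|nhi].
  case: (ch i) => [->|[ci _]]; first by left; rewrite mul0r.
  case: vt => [->|[zr tT]]; first by left; rewrite mulr0.
  by right; rewrite exprMn ci zr mulr1.
case: (ch i) => [->|[ci hT]]; first by left.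
by right; rewrite !inE nhi.
Qed.

Lemma cfgV_step T c h j z t f : config T c h -> j \in T ->
  pker (cfgV c h) (lin j z t) f <-> cfgV (cfg_c c h j z) (cfg_h h j t) f.
Proof.
move=> [cT ch] jT; have [cj hj] := cT j jT; rewrite /cfg_c /cfg_h; split.
  move=> [Vf]; rewrite pd_lin => /subr0_eq fj i.
  by case: eqVneq => [hi|_]; rewrite Vf // hi fj scalerA.
move=> Vf; have fj : f^`M(j) = z *: f^`M(t).
  by rewrite Vf hj eqxx cj mul1r.
split; last by rewrite pd_lin fj subrr.
move=> i; rewrite Vf; case: eqVneq => [->|//].
by rewrite -scalerA -fj.
Qed.

(* Multiplication by lam preserves cfgV c h and satisfies [pd l, lam] = 1 there,
   as for the creation and annihilation operators. *)
Lemma cosurj_lin T c h j z t : config T c h -> j \in T -> valid (T :\ j) z t ->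
  cosurj (cfgV c h) (lin j z t).
Proof.
move=> [cT ch] jT vt; have [cj hj] := cT j jT.
(* With these coefficients [lam] lies in [cfgV c h] itself and has derivative 1 along x_j and 0
   along the other independent variables. *)
pose a i : K := if h i == j then c i else 0.
pose lam : S := \sum_i a i *: 'X_i.
have lamE i : lam^`M(i) = (a i)%:MP.
  rewrite linear_sum (bigD1 i) //= big1 ?addr0 => [|k nki].
    rewrite linearZ /= mderivX mnm1E eqxx scale1r -[X in (X - _)%MM]add0m addmK mpolyX0.
    by rewrite -mul_mpolyC mulr1.
  by rewrite linearZ /= mderivX mnm1E (negbTE nki) scale0r scaler0.
have lamV f : cfgV c h f -> cfgV c h (lam * f).
  move=> Vf i; rewrite !mderivM !lamE Vf scalerDr -scalerAr; congr (_ + _).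
  rewrite scalerAl -mul_mpolyC -mpolyCM; congr (_%:MP * _).
  case: (ch i) => [ci|[_ hT]]; first by rewrite /a ci mul0r if_same.
  have [chi hhi] := cT _ hT; rewrite /a hhi chi.
  by case: ifP; rewrite ?mulr1 ?mulr0.
set l := lin j z t.
have lM u v : pd l (u * v) = pd l u * v + u * pd l v.
  rewrite !pd_lin !mderivM scalerDr mulrBl mulrBr opprD.
  by rewrite -scalerAl -scalerAr addrACA.
have llam : pd l lam = 1.
  rewrite pd_lin !lamE /a hj eqxx cj -mul_mpolyC -mpolyCM -mpolyCB.
  suff -> : z * (if h t == j then c t else 0) = 0 by rewrite subr0.
  case: vt => [->|[_]]; first by rewrite mul0r.
  rewrite !inE => /andP[ntj tT]; have [_ ->] := cT t tT.
  by rewrite (negbTE ntj) mulr0.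
have lX e f : pd l (lam ^+ e.+1 * f) =
    lam ^+ e * f *+ e.+1 + lam ^+ e.+1 * pd l f.
  rewrite lM; congr (_ + _); elim: e => [|e IHe].
    by rewrite expr1 llam expr0.
  rewrite exprS lM llam !mul1r mulrDl mulrSr addrC; congr (_ + _).
  by rewrite -mulrA IHe exprS -mulrA mulrnAr.
(* The power of [lam] is generalized because lifting [lam ^+ e * f] leaves the error
   [lam ^+ e.+1 * pd l f], in which [pd l f] has smaller degree than [f]. *)
suff gen k f e : (msize f <= k)%N -> cfgV c h f ->
    exists2 g, cfgV c h g & pd l g = lam ^+ e * f.
  by move=> f Vf; have := gen _ f 0 (leqnn _) Vf; rewrite expr0 mul1r.
have sV := submod_cfgV c h; have [V0 VB Vpd] := sV.
elim: k f e => [|k IHk] f e.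
  rewrite leqn0 msize_poly_eq0 => /eqP-> _.
  by exists 0; rewrite ?linear0 ?mulr0.
move=> szf Vf; have [||g Vg lg] := IHk (pd l f) e.+1; [|exact: Vpd|].
  by apply: leq_trans (lowering_lin _ _ _ _) _; case: (msize f) szf.
have VX : cfgV c h (lam ^+ e.+1 * f).
  elim: (e.+1) => [|q IHq]; first by rewrite mul1r.
  by rewrite exprS -mulrA; apply: lamV.
exists (e.+1%:R^-1 *: (lam ^+ e.+1 * f - g)).
  exact: (submodZ _ sV (VB _ _ VX Vg)).
rewrite linearZ linearB /= lX lg addrK -scaler_nat scalerA mulVf ?scale1r //.
by rewrite Num.Theory.pnatr_eq0.
Qed.

End Configurations.

Section PowerSumRegularity.
Variables (K : numClosedFieldType) (n r : nat).
Hypothesis r_gt0 : (0 < r)%N.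
Local Notation S := {mpoly K[n]}.
Local Notation y i := ('X_i ^+ r : S).
Local Notation pw := (pw K n r).
Local Notation valid := (valid r).
Local Notation config := (config r).
Implicit Types (f g : S) (T A : {set 'I_n}) (z : K) (c : 'I_n -> K) (h : 'I_n -> 'I_n).

Definition lprod i A g := exists2 zs : seq (K * 'I_n),
  (forall e, e \in zs -> valid A e.1 e.2) & g = \prod_(e <- zs) lin i e.1 e.2.

Lemma lprod1 i A : lprod i A 1.
Proof. by exists [::]; rewrite ?big_nil. Qed.

Lemma lprodM i A g g' : lprod i A g -> lprod i A g' -> lprod i A (g * g').
Proof.
move=> [zs vzs ->] [zs' vzs' ->]; exists (zs ++ zs'); last by rewrite big_cat.
by move=> e; rewrite mem_cat => /orP[/vzs|/vzs'].
Qed.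

Lemma lprodX i A k : lprod i A ('X_i ^+ k).
Proof.
exists (nseq k (0, i)) => [e|]; first by rewrite mem_nseq => /andP[_ /eqP->]; left.
by rewrite big_nseq /= /lin scale0r subr0 iter_mulr_1.
Qed.

Lemma lprod_prod_sub i A (B : {set 'I_n}) : B \subset A ->
  lprod i A (\prod_(t in B) (y i - y t)).
Proof.
move=> /subsetP BA; elim/big_rec: _ => [|t g tB lg]; first exact: lprod1.
apply: lprodM lg; have [zs /allP zr ->] := subXX_factor S r_gt0.
exists [seq (z, t) | z <- zs]; last by rewrite big_map.
by move=> _ /mapP[z /zr/eqP zr1 ->]; right; split=> //; apply: BA.
Qed.

Definition pws m : seq S := [seq pw k | k <- iota 1 m].

Lemma pwsS m : pws m.+1 = rcons (pws m) (pw m.+1).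
Proof. by rewrite /pws -[in LHS](addn1 m) iotaD map_cat cats1 add1n. Qed.

Lemma pkers_pws V m f : pkers V (pws m) f <->
  V f /\ forall k, (0 < k <= m)%N -> pd (pw k) f = 0.
Proof.
rewrite pkersP; split=> [] [Vf pf]; split=> //.
  by move=> k km; apply/pf/map_f; rewrite mem_iota add1n ltnS.
by move=> a /mapP[k]; rewrite mem_iota add1n ltnS => km ->; apply: pf.
Qed.

(** In the formula [pd_pwS] for T minus j, each [y i] acts as 0 or as [y (h i)]. The terms with
    [c i = 0] or [h i] different from j then contain a vanishing factor, and the others all equal
    the term at j; [w] counts the latter, j being one of them. *)
Lemma pd_pw_cfg T c h j : config T c h -> j \in T ->
  exists2 w : K, w != 0 & forall f, cfgV c h f ->
    (forall k, (0 < k < #|T|)%N -> pd (pw k) f = 0) ->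
    pd (pw #|T|) f = w *: pd (y j * \prod_(t in T :\ j) (y j - y t)) f.
Proof.
move=> [cT ch] jT; have [cj hj] := cT j jT.
have cardT : #|T| = #|T :\ j|.+1 by rewrite (cardsD1 j) jT.
pose P := [pred i | (c i != 0) && (h i == j)].
exists (#|P|%:R).
  rewrite Num.Theory.pnatr_eq0 -lt0n; apply/card_gt0P; exists j.
  by rewrite inE /= cj hj eqxx oner_eq0.
move=> f Vf pf; rewrite cardT pd_pwS => [|k /andP[k0 kT]]; last by rewrite pf // cardT ltnS k0.
pose q : {poly S} := 'X * \prod_(t in T :\ j) ('X - (y t)%:P).
have qE u : q.[u] = u * \prod_(t in T :\ j) (u - y t).
  by rewrite hornerM hornerX horner_prod; congr (_ * _); apply: eq_bigr => t _; rewrite !hornerE.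
rewrite (bigID P) /= [X in _ + X]big1 ?addr0 => [|i].
  rewrite -sum1_card natr_sum scaler_suml; apply: eq_bigr => i /andP[ci /eqP hi].
  rewrite scale1r -!qE; apply: pd_horner.
  case: (ch i) => [ci0|[cir _]]; first by rewrite ci0 eqxx in ci.
  by rewrite (cfgV_pd _ _ Vf) cir scale1r hi.
rewrite negb_and negbK => nPi.
have [ci|ci] := eqVneq (c i) 0.
  by rewrite mulrC pdMl (cfgV_pd _ _ Vf) ci expr0n eqn0Ngt r_gt0 scale0r linear0.
case: (ch i) => [ci0|[cir hT]]; first by rewrite ci0 eqxx in ci.
rewrite (negbTE ci) /= in nPi.
rewrite -qE (_ : pd q.[y i] f = pd q.[y (h i)] f); last first.
  by apply: pd_horner; rewrite (cfgV_pd _ _ Vf) cir scale1r.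
rewrite qE (bigD1 (h i)) /=; last by rewrite !inE nPi.
by rewrite subrr mul0r mulr0 pd0l.
Qed.

(** This stands in for finite dimension: it bounds the degrees of all elements of [V], see
    [msize_nilpotent]. *)
Definition nilpotent_on (V : S -> Prop) :=
  exists M, forall i f, V f -> pd ('X_i ^+ M) f = 0.

Lemma nilpotent_on_prod V (ls : seq S) : submod V ->
    (forall l, l \in ls -> nilpotent_on (pker V l)) ->
  nilpotent_on (pker V (\prod_(l <- ls) l)).
Proof.
move=> sV; have [_ _ Vpd] := sV; elim: ls => [|l ls IHls] nls.
  by exists 0 => i f [_]; rewrite big_nil expr0 !pd1l.
have [M nM] := nls l (mem_head _ _).
have [|M' nM'] := IHls; first by move=> l' l's; apply: nls; rewrite inE l's orbT.
exists (M + M')%N => i f [Vf]; rewrite big_cons mulrC pdMl => lf.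
rewrite exprD pdMl; apply: nM.
by split; [exact: Vpd | rewrite pdC; apply: nM'; split; [exact: Vpd|]].
Qed.

Lemma coreg_pws_lin m T c h j z t : #|T| = m.+1 -> config T c h -> j \in T ->
    valid (T :\ j) z t ->
    (forall c' h', config (T :\ j) c' h' -> coreg (cfgV c' h') (pws m)) ->
  coreg (cfgV c h) (lin j z t :: pws m).
Proof.
move=> cardT cfT jT vt creg; split; first exact: cosurj_lin cfT jT vt.
apply: coreg_ext (creg _ _ (config_step cfT jT vt)) => f.
by rewrite (cfgV_step _ _ _ cfT jT).
Qed.

(** Induction on the number of independent variables. The lower power sums are coregular because
    they are so on the kernel of d/dx_j ([coreg_drop]); the last one acts as a nonzero multiple of a
    product of linear forms, each of which removes x_j. *)
Lemma pws_regular m T c h : #|T| = m -> config T c h ->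
  coreg (cfgV c h) (pws m) /\ nilpotent_on (pkers (cfgV c h) (pws m)).
Proof.
elim: m T c h => [|m IHm] T c h cardT cfT.
  split=> //; exists 1%N => i f /= Vf; rewrite expr1 pdX Vf.
  case: cfT => _ /(_ i) [->|[_]]; first by rewrite scale0r.
  by rewrite (cards0_eq cardT) inE.
have [j jT] : exists j, j \in T by apply/card_gt0P; rewrite cardT.
have cardTj : #|T :\ j| = m by move: cardT; rewrite (cardsD1 j) jT => -[].
have sV := submod_cfgV c h; have sVp := submod_pkers (pws m) sV.
have cl z t : valid (T :\ j) z t -> coreg (cfgV c h) (lin j z t :: pws m).
  move=> vt; apply: coreg_pws_lin cardT cfT jT vt _ => c' h' cf'.
  by case: (IHm _ _ _ cardTj cf').
have [cX creg] := cl 0 j (or_introl erefl).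
have cregV := coreg_drop sV (lowering_lin _ _ _) cX creg.
have [zs vzs def_g] : lprod j (T :\ j) (y j * \prod_(t in T :\ j) (y j - y t)).
  by apply: lprodM; [exact: lprodX | exact: lprod_prod_sub].
have [w w0 pwE] := pd_pw_cfg cfT jT.
rewrite cardT def_g -(big_map (fun e : K * 'I_n => lin j e.1 e.2) predT id) /= in pwE.
set ls := map _ _ in pwE.
have {}pwE f : pkers (cfgV c h) (pws m) f ->
    pd (pw m.+1) f = w *: pd (\prod_(l <- ls) l) f.
  by move=> /pkers_pws[Vf pf]; apply: pwE.
have lsP l : l \in ls -> exists z t, valid (T :\ j) z t /\ l = lin j z t.
  by move=> /mapP[[z t] /vzs vt ->]; exists z, t.
split.
  rewrite pwsS; apply/coreg_rcons; split=> //.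
  have cls : cosurj (pkers (cfgV c h) (pws m)) (\prod_(l <- ls) l).
    apply: cosurj_prod => // l /lsP[z [t [vt ->]]].
    by have [cl1 cl2] := cl z t vt; apply: coreg_exchange.
  move=> f Vf; have [g Vg lg] := cls (w^-1 *: f) (submodZ _ sVp Vf).
  by exists g => //; rewrite pwE // lg scalerA divff ?scale1r.
rewrite pwsS.
have [M nM] : nilpotent_on (pker (pkers (cfgV c h) (pws m)) (\prod_(l <- ls) l)).
  apply: nilpotent_on_prod => // l /lsP[z [t [vt ->]]].
  have [_ [M nM]] := IHm _ _ _ cardTj (config_step cfT jT vt).
  exists M => i f [/pkers_pws[Vf pf] lf]; apply: nM; apply/pkers_pws; split=> //.
  by apply/(cfgV_step _ _ _ cfT jT).
exists M => i f; rewrite -pwsS => /pkers_pws[Vf pf]; apply: nM.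
have fV : pkers (cfgV c h) (pws m) f.
  by apply/pkers_pws; split=> // k /andP[k0 km]; rewrite pf // k0 leqW.
split=> //; have := pwE f fV; rewrite pf ?leqnn //.
by move=> /esym/eqP; rewrite scaler_eq0 (negbTE w0) => /eqP.
Qed.

End PowerSumRegularity.

(** * Harmonic polynomials and their socle *)

Section Socle.
Variables (K : numClosedFieldType) (n r : nat).
Hypothesis r_gt0 : (0 < r)%N.
Local Notation S := {mpoly K[n]}.
Local Notation y i := ('X_i ^+ r : S).
Local Notation pw := (pw K n r).
Local Notation pws := (pws K n r).
Local Notation config := (config r).
Implicit Types (f g q : S) (T A : {set 'I_n}) (c : 'I_n -> K) (h : 'I_n -> 'I_n).

(** Each linear factor of [g i] eliminates x_i in favour of 0 or a multiple of some x_t with t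
    outside J. The other [g k] keep their form, since besides x_k they only refer to such x_t; once
    all of J is eliminated, m independent variables and m power sums are left. *)
Lemma coreg_lprod_pws m (J : seq 'I_n) T c h (g : 'I_n -> S) :
    config T c h -> uniq J -> {subset J <= T} -> #|T| = (size J + m)%N ->
    (forall i, i \in J -> lprod r i [set t in T | t \notin J] (g i)) ->
  coreg (cfgV c h) ([seq g i | i <- J] ++ pws m).
Proof.
elim: J T c h => [|i J IHJ] T c h cfT uJ sJT cardT lg.
  by case: (pws_regular r_gt0 cardT cfT).
have [zs vzs gE] := lg i (mem_head _ _).
have iT : i \in T by apply: sJT; apply: mem_head.
have sV := submod_cfgV c h.
have /andP[iJ uJ'] := uJ.
rewrite /= gE -(big_map (fun e : K * 'I_n => lin i e.1 e.2) predT id).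
apply: coreg_prod => // l /mapP[[z t] /vzs /= vt ->].
have vt' : valid r (T :\ i) z t.
  case: vt => [->|[zr]]; [by left | right; split=> //].
  by move: b; rewrite !inE negb_or => /and3P[-> -> _].
split; first exact: cosurj_lin cfT iT vt'.
have := IHJ _ _ _ (config_step cfT iT vt').
have -> : [set t0 in T :\ i | t0 \notin J] = [set t0 in T | t0 \notin i :: J].
  by apply/setP=> t0; rewrite !inE negb_or; case: eqP; rewrite ?andbF.
move=> IH; apply: coreg_ext (IH uJ' _ _ _) => [f|k kJ||k kJ].
- by rewrite (cfgV_step _ _ _ cfT iT).
- rewrite !inE sJT ?inE ?kJ ?orbT // andbT.
  by apply: contraNneq iJ => <-.
- by move: cardT; rewrite (cardsD1 i) iT /= addSn => -[].
- by apply: lg; rewrite inE kJ orbT.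
Qed.

(** The indicator coefficients force d/dx_i to vanish for i outside T, so these are the polynomials
    in the x_t with t in T that are harmonic for the wreath product acting on these variables. *)
Definition harm T := pkers (cfgV (fun i => (i \in T)%:R : K) id) (pws #|T|).

Lemma config_indicator T : config T (fun i => (i \in T)%:R : K) id.
Proof.
split=> [t ->|i]; first by [].
by case: (boolP (i \in T)) => iT; [right; rewrite expr1n | left].
Qed.

(* The derivatives of elements of [harm T] span a subspace of codimension at most
   one in [harm T], detected by [pd s].  The next power sum factors as X_j * v on
   the kernel of the lower ones, so that s = s' * v when s' works for T - j. *)
Lemma socle_functional T : exists s, forall q, harm T q ->
  (forall i, (pd s q)^`M(i) = 0) /\
  (pd s q = 0 -> exists2 F : 'I_n -> S,
     forall i, harm T (F i) & q = \sum_i (F i)^`M(i)).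
Proof.
move eqm: #|T| => m; elim: m T eqm => [|m IHm] T cardT.
  exists 1 => q; rewrite /harm cardT /= => Vq; rewrite pd1l.
  have Tx i : i \in T = false by rewrite (cards0_eq cardT) inE.
  split=> [i|->]; first by rewrite Vq Tx scale0r.
  exists (fun=> 0); last by rewrite big1 // => i _; rewrite linear0.
  by move=> i; have [] := submod_cfgV (fun i : 'I_n => (i \in T)%:R : K) id.
have [j jT] : exists j, j \in T by apply/card_gt0P; rewrite cardT.
have cardTj : #|T :\ j| = m by move: cardT; rewrite (cardsD1 j) jT => -[].
have [s' sP] := IHm _ cardTj.
have cfT := config_indicator T; set c := fun i => _ in cfT.
have sV : submod (cfgV c id) := submod_cfgV c id.
have sVp := submod_pkers (pws m) sV; set V := pkers _ _ in sVp.
have [V0 VB Vpd] := sVp.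
have cl z t : valid r (T :\ j) z t -> cosurj V (lin j z t).
  move=> vt; have [c' h'|cl1 cl2] := coreg_pws_lin cardT cfT jT vt.
    by case/(pws_regular r_gt0 cardTj).
  exact: coreg_exchange.
pose v := 'X_j ^+ r.-1 * \prod_(t in T :\ j) (y j - y t).
have cu : cosurj V 'X_j.
  by have := cl 0 j (or_introl erefl); rewrite /lin scale0r subr0.
have cv : cosurj V v.
  have [zs vzs ->] : lprod r j (T :\ j) v.
    by apply: lprodM; [apply: lprodX | apply: lprod_prod_sub].
  rewrite -(big_map (fun e : K * 'I_n => lin j e.1 e.2) predT id).
  by apply: cosurj_prod => // l /mapP[[z t] /vzs /= vt ->]; apply: cl.
have [w w0 pwE] := pd_pw_cfg r_gt0 cfT jT.
have {}pwE q : V q -> pd (pw m.+1) q = w *: pd 'X_j (pd v q).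
  move=> /pkers_pws[Vq pq]; rewrite -cardT pwE //; last by rewrite cardT.
  by rewrite -pdMl /v mulrA -exprS prednK.
have harmT q : harm T q <-> V q /\ pd 'X_j (pd v q) = 0.
  rewrite /harm cardT pwsS -cats1 /pkers foldl_cat /= -/(pkers _ _) -/V.
  split=> -[Vq uvq]; split=> //; last by rewrite pwE // uvq scaler0.
  by move/eqP: uvq; rewrite pwE // scaler_eq0 (negbTE w0) => /eqP.
have harmTj q : harm (T :\ j) q <-> V q /\ pd 'X_j q = 0.
  rewrite /harm /V cardTj !pkers_pws pdX; split=> [[Vq pq]|[[Vq pq] qj]].
    have qj : q^`M(j) = 0 by rewrite Vq !inE eqxx scale0r.
    split=> //; split=> // i; rewrite {1}Vq !inE /c.
    by case: eqVneq => [->|//]; rewrite qj !scaler0.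
  split=> // i; rewrite {1}Vq !inE /c.
  by case: eqVneq => [->|//]; rewrite qj !scaler0.
exists (s' * v) => q /harmT[Vq uvq].
have vq : harm (T :\ j) (pd v q) by apply/harmTj; split=> //; apply: Vpd.
have [const ker] := sP _ vq; split=> [i|]; first by rewrite pdMl.
rewrite pdMl => /ker[F hF vqE].
(* After the [F i] are lifted along [v], the remainder [q'] is killed by [v]. A lift [g] of it along
   X_j is therefore killed by X_j * v, so it is again in [harm T] and makes [q'] a derivative. *)
have /fin_all_exists2[G VG vG] i : exists2 g, V g & pd v g = F i.
  by apply: cv; case/harmTj: (hF i).
pose q' := q - \sum_i (G i)^`M(i).
have Vq' : V q'.
  by apply: VB => //; apply: submod_sum => // i _; rewrite -pdX; apply: Vpd.
have vq' : pd v q' = 0.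
  rewrite linearB /= vqE [X in _ - X]linear_sum -sumrB big1 // => i _.
  by rewrite -vG -pd_mderiv subrr.
have [g Vg ug] := cu _ Vq'.
have hG i : harm T (G i).
  by apply/harmT; split=> //; rewrite vG; case/harmTj: (hF i).
have hg : harm T g by apply/harmT; split=> //; rewrite pdC ug.
exists (fun i => G i + (if i == j then g else 0)).
  move=> i; apply: submodD => //; first exact: submod_pkers.
  by case: ifP => // _; have [] := submod_pkers (pws #|T|) sV.
rewrite (eq_bigr (fun i => (G i)^`M(i) + (if i == j then g^`M(i) else 0))).
  by rewrite big_split /= -big_mkcond big_pred1_eq -pdX ug addrC subrK.
by move=> i _; rewrite mderivD; case: ifP => _; rewrite ?linear0.
Qed.

(** The coefficient reappears in the M-th derivative, multiplied by an integer that is nonzero in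
    characteristic zero. *)
Lemma mcoeff_eq0_pdX f M i (m : 'X_{1..n}) : pd ('X_i ^+ M) f = 0 -> (M <= m i)%N -> f@_m = 0.
Proof.
move=> fM Mm; have := congr1 (mcoeff (m - U_(i) *+ M)) fM.
rewrite mcoeff0 mpolyXn pdXm mcoeff_mderivm addmC submK; last first.
  apply/mnm_lepP => k; rewrite mulmnE mnm1E.
  by case: eqVneq => [<-|]; rewrite ?mul1n.
move/eqP; rewrite Num.Theory.mulrn_eq0 => /orP[|/eqP //].
rewrite -leqn0 leqNgt prodn_gt0 // => k; rewrite ffact_gt0 mulmnE mnm1E.
by case: eqVneq => [<-|]; rewrite ?mul1n.
Qed.

Lemma msize_nilpotent f M : (forall i, pd ('X_i ^+ M) f = 0) ->
  (msize f <= (n * M).+1)%N.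
Proof.
move=> fM; rewrite msizeE; apply/bigmax_leqP_seq => m; rewrite mcoeff_msupp => fm _.
rewrite ltnS mdegE -[X in (X * _)%N]card_ord -sum_nat_const leq_sum // => i _.
by rewrite leqNgt; apply: contraNN fm => /ltnW/(mcoeff_eq0_pdX (fM i)) ->.
Qed.

Lemma mderiv0_const f : (forall i, f^`M(i) = 0) -> f = (f@_0)%:MP.
Proof.
move=> f0; apply: msize1_polyC; rewrite msizeE; apply/bigmax_leqP_seq => m.
rewrite mcoeff_msupp ltnS leqn0 mdeg_eq0 => fm _; apply/eqP/mnmP => i.
rewrite mnm0E; apply/eqP; rewrite -leqn0 leqNgt; apply: contraNN fm => mi.
by apply/eqP; apply: (@mcoeff_eq0_pdX _ 1 i) => //; rewrite expr1 pdX.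
Qed.

Definition harmonic f := forall k, (0 < k <= n)%N -> pd (pw k) f = 0.

Lemma harmonicE f : harm setT f <-> harmonic f.
Proof.
rewrite /harm cardsT card_ord pkers_pws; split=> [[]//|hf]; split=> // i.
by rewrite inE scale1r.
Qed.

(* D generates because it spans the socle functional: q |-> pd s q has the same
   kernel as q |-> pd D q on harmonic polynomials. *)
Lemma harmonic_cyclic D : harmonic D ->
    (forall i q, harmonic q -> pd ('X_i * D) q = 0) -> pd D D <> 0 ->
  forall q, harmonic q -> exists a, q = pd a D.
Proof.
move=> /harmonicE hD XD DD.
have sV : submod (harm setT) by apply/submod_pkers/submod_cfgV.
have [s sP] := socle_functional setT; have [_ VB Vpd] := sV.
have sc q : harm setT q -> pd s q = ((pd s q)@_0)%:MP.
  by move=> /sP[/mderiv0_const].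
have sD0 : (pd s D)@_0 != 0.
  apply/eqP => sD; case: (sP D hD) => _ []; first by rewrite sc // sD.
  move=> F hF DF; case: DD; rewrite {2}DF linear_sum big1 //= => i _.
  by rewrite -pdX -pdMl mulrC XD //; apply/harmonicE.
have [_ [M nM]] : coreg (cfgV (fun i => (i \in setT)%:R : K) id) (pws #|[set: 'I_n]|)
   /\ nilpotent_on (harm setT) by apply: pws_regular (config_indicator _).
(* Every round of approximation lowers the bound on the remainder by one, starting from the bound
   that nilpotency gives. *)
suff gen k q : harm setT q -> exists a, (msize (q - pd a D) <= (n * M).+1 - k)%N.
  move=> q /harmonicE/(gen (n * M).+1)[a]; rewrite subnn leqn0 msize_poly_eq0.
  by move=> /eqP/subr0_eq ->; exists a.
elim: k q => [|k IHk] q hq.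
  exists 0; rewrite pd0l subr0 subn0; apply: msize_nilpotent => i; exact: nM.
(* The scalar makes [pd s] vanish on [q - e *: D], which is then a sum of derivatives of harmonic
   polynomials; these are approximated by the induction hypothesis. *)
pose e := (pd s q)@_0 / (pd s D)@_0.
have hq' : harm setT (q - e *: D) by apply: VB => //; apply: submodZ.
have [_ []] := sP _ hq'.
  rewrite linearB linearZ /= sc // [pd s D]sc // -mul_mpolyC -mpolyCM.
  by rewrite divfK // subrr.
move=> F hF qF; have /fin_all_exists[a aP] i := IHk (F i) (hF i).
exists (e%:MP + \sum_i 'X_i * a i); rewrite pdDl opprD addrA.
rewrite -[e%:MP]mulr1 mul_mpolyC pdZl pd1l qF pd_suml -sumrB.
apply: leq_trans (msize_sum _ _ _) _; apply/bigmax_leqP => i _.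
rewrite pdMl pdX -mderivB; apply: leq_trans (msize_mderiv _ _) _.
by rewrite subnS; case: (msize _) (aP i) => // b /=; case: (_ - _)%N.
Qed.

End Socle.

(** * Linkage through the factors of the Euler operators *)

Section Linkage.
Variables (K : numClosedFieldType) (n r : nat).
Hypothesis r_gt0 : (0 < r)%N.
Local Notation S := {mpoly K[n]}.
Local Notation y i := ('X_i ^+ r : S).
Local Notation pw := (pw K n r).
Local Notation pws := (pws K n r).
Implicit Types (f g q : S) (J : {set 'I_n}).

Definition lower_gap J (i : 'I_n) := [set l : 'I_n | (l < i)%N & l \notin J].

Definition col_gen J i : S :=
  'X_i ^+ r.-1 * \prod_(l in lower_gap J i) (y i - y l).

Definition upper_factor (j : 'I_n) : S :=
  'X_j * \prod_(t in [set t : 'I_n | (j < t)%N]) (y j - y t).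

Definition upper_factors J : S := \prod_(j in J) upper_factor j.

(** [upper_factor j] is a product of forms x_j - z x_t. Each of them removes x_j, and the
    [col_gen J i] only use indices below j, so [coreg_lprod_pws] applies to the n - 1 other
    variables and exchange gives surjectivity. *)
Lemma cosurj_upper_factor J (j : 'I_n) m : {in J, forall i : 'I_n, (i < j)%N} ->
    (n = #|J| + m.+1)%N ->
  cosurj (pkers (fun=> True) ([seq col_gen J i | i <- enum J] ++ pws m))
         (upper_factor j).
Proof.
move=> Jj nE; set s := _ ++ _.
have cfT := config_indicator K r [set: 'I_n]; set c := fun i => _ in cfT.
have VT f : True <-> cfgV c id f by split=> // _ i; rewrite /c inE scale1r.
have jJ : j \notin J by apply/negP => /Jj; rewrite ltnn.
have [zs vzs ->] : lprod r j (setT :\ j) (upper_factor j).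
  apply: lprodM; first by rewrite -['X_j]expr1; apply: lprodX.
  apply: lprod_prod_sub => //; apply/subsetP => t; rewrite !inE andbT => jt.
  by apply: contraTneq jt => ->; rewrite ltnn.
rewrite -(big_map (fun e : K * 'I_n => lin j e.1 e.2) predT id).
apply: cosurj_prod => [|l /mapP[[z t] /vzs /= vt ->]]; first exact: submod_pkers.
have jT : j \in setT by rewrite inE.
apply: (cosurj_ext (V := pkers (cfgV c id) s) (a := lin j z t)) => // [f|].
  by rewrite !pkersP -VT.
apply: coreg_exchange; first exact: submod_cfgV.
  exact: cosurj_lin cfT jT vt.
apply: coreg_ext (fun f => iff_sym (cfgV_step z t f cfT jT)) _.
apply: coreg_lprod_pws (config_step cfT jT vt) _ _ _ _ => //.
- exact: enum_uniq.
- move=> i; rewrite mem_enum !inE andbT => iJ.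
  by apply: contraNneq jJ => <-.
- have := cardsD1 j [set: 'I_n]; rewrite cardsT card_ord inE add1n -cardE => nS.
  by apply/eqP; rewrite -eqSS -nS {1}nE addnS.
- move=> i; rewrite mem_enum => iJ; apply: lprodM; first exact: lprodX.
  apply: lprod_prod_sub => //; apply/subsetP => u; rewrite !inE mem_enum => /andP[li ->].
  by rewrite !andbT; apply: contraTneq (ltn_trans li (Jj i iJ)) => ->; rewrite ltnn.
Qed.

(** As j is the largest element of J, the complement of J consists of [lower_gap J j] and all
    indices above j. *)
Lemma col_gen_upper_factor J (j : 'I_n) : {in J, forall i : 'I_n, (i <= j)%N} -> j \in J ->
  y j * \prod_(t in ~: J) (y j - y t) = col_gen J j * upper_factor j.
Proof.
move=> Jj jJ; rewrite /col_gen /upper_factor mulrACA -exprSr prednK //; congr (_ * _).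
rewrite (bigID (fun t : 'I_n => (t < j)%N)) /=; congr (_ * _); apply: eq_bigl => t.
  by rewrite !inE andbC.
rewrite !inE -leqNgt leq_eqVlt; case: (boolP (t \in J)) => /= [tJ|tJ].
  by rewrite ltnNge Jj.
by case: eqVneq => // /val_inj jt; rewrite -jt jJ in tJ.
Qed.

(* If j exceeds all elements of J0, then on the kernel of the [col_gen J0 i] and
   of the lower power sums, the next power sum is the product of [col_gen J j]
   and [upper_factor j]; moreover [upper_factor j] acts surjectively there. *)
Lemma linkage D : (forall q, harmonic r q -> exists a, q = pd a D) ->
  forall J q, (forall k, (0 < k <= n - #|J|)%N -> pd (pw k) q = 0) ->
    (forall i, i \in J -> pd (col_gen J i) q = 0) ->
  exists a, q = pd a (pd (upper_factors J) D).
Proof.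
move=> cyc J; move eqk: #|J| => k; elim: k J eqk => [|k IHk] J cardJ q pq gq.
  have [|a ->] := cyc q; first by move=> i iN; apply: pq; rewrite subn0.
  by exists a; rewrite /upper_factors (cards0_eq cardJ) big_set0 pd1l.
have [j0 j0J] : exists j, j \in J by apply/card_gt0P; rewrite cardJ.
have [j jJ jmax] : exists2 j : 'I_n, j \in J & {in J, forall i : 'I_n, (i <= j)%N}.
  by case: (arg_maxnP (fun i : 'I_n => val i) j0J) => j; exists j.
pose J0 := J :\ j; pose m := (n - k.+1)%N.
have cardJ0 : #|J0| = k by move: cardJ; rewrite (cardsD1 j) jJ => -[].
have nE : n = (#|J0| + m.+1)%N.
  have : (#|J| <= n)%N by rewrite -[X in (_ <= X)%N]card_ord max_card.
  by rewrite cardJ0 cardJ /m addnS -addSn => /subnKC.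
have J0j : {in J0, forall i : 'I_n, (i < j)%N}.
  by move=> i; rewrite !inE ltn_neqAle => /andP[nij /jmax ->]; rewrite andbT.
have gE i : i \in J0 -> col_gen J i = col_gen J0 i.
  move=> iJ0; congr (_ * _); apply: eq_bigl => l; rewrite !inE.
  case: eqVneq => [->|//]; have := J0j i iJ0; rewrite ltnNge => /negbTE.
  by case: ltngtP.
(* The lift [q'] of [q] along [upper_factor j] will satisfy the hypotheses for [J0], hence be a
   derivative of the image of [D] under [upper_factors J0]; applying [upper_factor j] then gives the
   claim. *)
have [|q' /pkersP[_ q'P] vq'] := cosurj_upper_factor J0j nE (f := q).
  apply/pkersP; split=> // a; rewrite mem_cat => /orP[/mapP[i]|/mapP[i]].
    by rewrite mem_enum => iJ0 ->; rewrite -gE // gq //; case/setD1P: iJ0.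
  by rewrite mem_iota add1n ltnS => im ->; apply: pq.
have pq' i : (0 < i <= m)%N -> pd (pw i) q' = 0.
  by move=> im; apply: q'P; rewrite mem_cat map_f ?orbT // mem_iota add1n ltnS.
have gq' i : i \in J0 -> pd (col_gen J0 i) q' = 0.
  by move=> iJ0; apply: q'P; rewrite mem_cat map_f // mem_enum.
have [||a q'E] := IHk J0 cardJ0 q'; last first.
- exists a; rewrite /upper_factors (big_setD1 j jJ) /= -vq' {1}q'E.
  by rewrite [LHS]pdC [in RHS]pdMl.
- exact: gq'.
have cardB : #|~: J| = m by rewrite cardsCs setCK cardJ card_ord.
move=> i; rewrite -cardJ0 [in X in (X - _)%N]nE addKn => /andP[i0].
rewrite leq_eqVlt => /predU1P[->|im]; last by apply: pq'; rewrite i0.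
(* Only the power sum of index m + 1 remains. In its expansion over the complement of J, an index i
   outside J gives a zero factor, i = j gives [col_gen J j] applied to [q], and every other i in J
   gives a multiple of [col_gen J0 i]. *)
rewrite -cardB pd_pwS => [|s]; last by rewrite cardB => /pq'.
rewrite big1 // => {i0} i _; have [iJ|iJ] := boolP (i \in J); last first.
  by rewrite (bigD1 i) ?inE //= subrr mul0r mulr0 pd0l.
have [->|nij] := eqVneq i j.
  by rewrite col_gen_upper_factor // pdMl vq' gq.
have iJ0 : i \in J0 by rewrite !inE nij.
rewrite (bigID (mem (lower_gap J i))) /=.
rewrite (eq_bigl (mem (lower_gap J i))) => [|l]; last first.
  by rewrite !inE; case: (l \in J); rewrite ?andbF.
have yE : y i = 'X_i * 'X_i ^+ r.-1 by rewrite -exprS prednK.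
rewrite {1}yE [X in _ * X]mulrC mulrACA pdMl -/(col_gen J i).
by rewrite gE // gq' // linear0.
Qed.

End Linkage.

(** * The polynomial delta *)

Section Delta.
Variables (K : numClosedFieldType) (n r : nat).
Hypothesis r_gt0 : (0 < r)%N.
Local Notation S := {mpoly K[n]}.
Local Notation y i := ('X_i ^+ r : S).
Local Notation delta := (delta K n r).
Implicit Types (f g p q : S) (s : 'S_n) (m : 'X_{1..n}).

Lemma mpoly_ring_ind (P : S -> Prop) :
    P 1 -> (forall a f, P f -> P (a *: f)) -> (forall f g, P f -> P g -> P (f + g)) ->
    (forall i f, P f -> P ('X_i * f)) ->
  forall f, P f.
Proof.
move=> P1 PZ PD PX f; rewrite (mpolyE f).
elim/big_rec: _ => [|m g _ Pg]; first by rewrite -(scale0r 1); apply: PZ.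
apply: PD Pg; apply: PZ; rewrite mpolyXE_id.
elim/big_rec: _ => // i g' _ Pg'; elim: (m i) => [|k IHk]; first by rewrite mul1r.
by rewrite exprS -mulrA; apply: PX.
Qed.

Lemma msym_mderiv s i f : msym s f^`M(i) = (msym s f)^`M(s i).
Proof.
apply/mpolyP => m; rewrite mcoeff_sym !mcoeff_mderiv mcoeff_sym mnmE.
congr (f@__ *+ _); apply/mnmP => k; rewrite !(mnmDE, mnmE) (inj_eq perm_inj).
by [].
Qed.

Lemma msym_Xi s i : msym s 'X_i = 'X_(s i) :> S.
Proof.
rewrite msymX; congr 'X_[_]; apply/mnmP => k; rewrite mnmE !mnm1E.
by rewrite (canF_eq (permK s)).
Qed.

Lemma msym_pd s f g : msym s (pd f g) = pd (msym s f) (msym s g).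
Proof.
elim/mpoly_ring_ind: f g => [g|a f IHf g|f f' IHf IHf' g|i f IHf g].
- by rewrite msym1 !pd1l.
- by rewrite msymZ !pdZl msymZ IHf.
- by rewrite msymD !pdDl msymD IHf IHf'.
- by rewrite msymM !pdMl msym_Xi !pdX msym_mderiv IHf.
Qed.

Definition delta_mnm s : 'X_{1..n} := [multinom r.-1 + r * (s^-1)%g j | j < n].

Lemma delta_vandermonde : delta =
  (\prod_(i < n) 'X_i) ^+ r.-1 * \det (Vandermonde n (\row_j - y j)).
Proof.
rewrite det_Vandermonde; congr (_ * _); apply: eq_bigr => i _.
by apply: eq_bigr => j _; rewrite !mxE opprK addrC.
Qed.

(** The Leibniz expansion of the Vandermonde determinant; that the coefficients are real serves the
    positivity argument in [pd_delta_delta]. *)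
Lemma deltaE : exists2 e : 'S_n -> K, (forall s, e s \is Num.real) &
  delta = \sum_s e s *: 'X_[delta_mnm s].
Proof.
exists (fun s => (-1) ^+ s * \prod_(i < n) (-1) ^+ i) => [s|].
  by rewrite rpredM ?rpred_prod // => *; rewrite rpredX ?rpredN ?rpred1.
rewrite delta_vandermonde mulr_sumr; apply: eq_bigr => s _.
under eq_bigr do rewrite !mxE exprNn.
rewrite big_split /= -mul_mpolyC rmorphM rmorphXn rmorphN1 rmorph_prod /=.
under [in RHS]eq_bigr do rewrite rmorphXn rmorphN1.
rewrite mulrCA -[RHS]mulrA; congr (_ * _); rewrite mulrCA; congr (_ * _).
rewrite [X in _ * X](reindex_inj (@perm_inj _ (s^-1)%g)) /= -prodrXl -big_split /=.
rewrite mpolyXE_id; apply: eq_bigr => j _.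
by rewrite permKV mnmE -exprM -exprD.
Qed.

Lemma msym_delta s : msym s delta = (-1) ^+ s * delta.
Proof.
rewrite delta_vandermonde rmorphM rmorphXn rmorph_prod /= -det_map_mx mulrCA.
congr (_ * _).
  by rewrite [in RHS](reindex_inj (@perm_inj _ s)) /=; under eq_bigr do rewrite msym_Xi.
rewrite (_ : map_mx _ _ = col_perm s (Vandermonde n (\row_j - y j))).
  by rewrite col_permE det_mulmx det_perm odd_permV mulrC.
apply/matrixP => i j; rewrite !mxE rmorphXn rmorphN rmorphXn /= msym_Xi.
by [].
Qed.

Lemma delta_neq0 : delta != 0.
Proof.
rewrite mulf_neq0 //.
  rewrite expf_neq0 //; apply/prodf_neq0 => i _; apply/eqP.
  by move/(congr1 (mcoeff U_(i)))/eqP; rewrite mcoeffX eqxx mcoeff0 oner_eq0.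
apply/prodf_neq0 => i _; apply/prodf_neq0 => j ij; apply/eqP.
move/(congr1 (mcoeff (U_(i) *+ r))); rewrite mcoeffB !mpolyXn !mcoeffX eqxx mcoeff0.
case: eqP => [/mnmP/(_ i)|_]; last by move/eqP; rewrite subr0 oner_eq0.
rewrite !mulmnE !mnm1E eqxx mul1n; case: eqVneq => [ji|_].
  by move: ij; rewrite ji ltnn.
by move/esym/eqP; rewrite mul0n eqn0Ngt r_gt0.
Qed.

Lemma mcoeff0_pd f g : (pd f g)@_0 =
  \sum_(m <- msupp f) f@_m * g@_m *+ \prod_(i < n) (m i)`!.
Proof.
rewrite /pd raddf_sum /=; apply: eq_bigr => m _.
rewrite mcoeffZ mcoeff_mderivm addm0 mulrnAr; congr (_ *+ _).
by apply: eq_bigr => i _; rewrite ffactnn.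
Qed.

(** The constant term is a sum of squares of real coefficients weighted by products of factorials,
    so its vanishing would force [delta = 0]. *)
Lemma pd_delta_delta : pd delta delta <> 0.
Proof.
move/(congr1 (mcoeff 0)); rewrite mcoeff0 mcoeff0_pd => /eqP.
have [e er dE] := deltaE.
have dr m : delta@_m \is Num.real.
  rewrite dE raddf_sum /= rpred_sum // => s _.
  by rewrite mcoeffZ mcoeffX rpredM ?rpred_nat.
rewrite Num.Theory.psumr_eq0 => [/allP d0|m _]; last first.
  by rewrite Num.Theory.mulrn_wge0 // -expr2 Num.Theory.real_exprn_even_ge0.
case/negP: delta_neq0; apply/eqP/mpolyP => m; rewrite mcoeff0; apply/eqP.
rewrite mcoeff_eq0; apply/negP => ms; have := d0 m ms.
rewrite Num.Theory.mulrn_eq0 mulf_eq0 orbb mcoeff_eq0 ms orbF.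
by rewrite -leqn0 leqNgt prodn_gt0 // => i; rewrite fact_gt0.
Qed.

(** Once sorted, the values increase strictly, so the i-th one is at least i. *)
Lemma sum_injective_geq (q : 'I_n -> nat) : injective q ->
  (\sum_(i < n) i <= \sum_(i < n) q i)%N.
Proof.
move=> q_inj; pose t := sort leq (codom q).
have szt : size t = n by rewrite size_sort size_codom card_ord.
have t_lt : sorted ltn t.
  by rewrite ltn_sorted_uniq_leq sort_uniq sort_sorted ?andbT ?codomP;
     [apply/injectiveP | apply: leq_total].
have t_ge i : (i < n)%N -> (i <= nth 0 t i)%N.
  elim: i => // i IHi lt_in; apply: leq_ltn_trans (IHi (ltnW lt_in)) _.
  by apply: (sorted_ltn_nth ltn_trans 0 t_lt); rewrite ?inE ?szt // ltnW.
have -> : (\sum_(i < n) q i = \sum_(x <- t) x)%N.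
  by rewrite (perm_big (codom q)) ?perm_sort //= big_image.
by rewrite (big_nth 0) szt big_mkord leq_sum // => i _; apply: t_ge.
Qed.

(* All exponents in [pd p delta] are congruent to -1 mod r, and they are distinct
   within a monomial by antisymmetry; such a monomial has degree at least that
   of delta. *)
Lemma pd_delta_invariant p : (forall i j, msym (tperm i j) p = p) ->
    (forall m, m \in msupp p -> forall i, (r %| m i)%N) -> p@_0 = 0 ->
  pd p delta = 0.
Proof.
move=> psym pr p0; set h := pd p delta; apply/mpolyP => m; rewrite mcoeff0.
apply/eqP; apply/negP => /negP hm.
have [k kp [s dk]] : exists2 k, k \in msupp p & exists s, delta_mnm s = (k + m)%MM.
  have [e _ dE] := deltaE; move: hm; rewrite /h dE /pd raddf_sum /=.
  have [/hasP[k kp /existsP[s /eqP dk]] _|] :=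
    boolP (has (fun k => [exists s, delta_mnm s == k + m]%MM) (msupp p)).
    by exists k => //; exists s.
  move=> /hasPn nk /eqP[]; rewrite big_seq big1 // => k /nk; rewrite negb_exists.
  move=> /forallP nks; rewrite mcoeffZ linear_sum raddf_sum /= big1 ?mulr0 // => s _.
  rewrite linearZ mcoeffZ mcoeff_mderivm mcoeffX (negbTE (nks s)).
  by rewrite mul0rn mulr0.
pose q i := (m i %/ r)%N.
have mE i : (m i = r.-1 + r * q i)%N.
  rewrite [LHS](divn_eq _ r) addnC mulnC; congr (_ + _)%N.
  have := congr1 (fun m' : 'X_{1..n} => m' i %% r)%N dk.
  have /eqP kr := pr k kp i.
  rewrite mnmDE mnmE -[RHS]modnDml kr add0n => <-.
  by rewrite mulnC addnC modnMDl modn_small // prednK.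
have q_inj : injective q.
  move=> i j qij; apply/eqP; apply: contraNT hm => nij.
  have : (msym (tperm i j) h)@_m = h@_m.
    rewrite mcoeff_sym; congr (h@__); apply/mnmP => l; rewrite mnmE.
    by case: tpermP => [->|->|//]; rewrite !mE qij.
  rewrite msym_pd psym msym_delta odd_tperm nij expr1 mulN1r linearN mcoeffN.
  by move/eqP; rewrite Num.Theory.eqNr.
have := congr1 (@mdeg n) dk; rewrite mdegD !mdegE.
under eq_bigr do rewrite mnmE; under [in X in _ = (_ + X)%N]eq_bigr do rewrite mE.
rewrite !big_split /= -!big_distrr /= addnCA => /addnI.
have -> : (\sum_(i < n) (s^-1)%g i = \sum_(i < n) i)%N.
  by rewrite [RHS](reindex_inj (@perm_inj _ (s^-1)%g)).
move=> dE.
have : (mdeg k == 0)%N.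
  rewrite mdegE -leqn0 -(leq_add2r (r * \sum_i q i)) -dE add0n leq_mul2l.
  by rewrite sum_injective_geq ?orbT.
by rewrite mdeg_eq0 => /eqP k0; rewrite k0 mcoeff_msupp p0 eqxx in kp.
Qed.

Lemma harmonic_delta : harmonic r delta.
Proof.
move=> k /andP[k_gt0 _]; apply: pd_delta_invariant => [i j|m|].
- rewrite rmorph_sum [RHS](reindex_inj (@perm_inj _ (tperm i j))) /=.
  by apply: eq_bigr => l _; rewrite !rmorphXn /= msym_Xi.
- move=> /msupp_sum_le /flattenP[/= t /mapP[i _ ->]].
  rewrite -exprM mpolyXn msuppX inE => /eqP -> l.
  by rewrite mulmnE mulnCA dvdn_mulr.
- rewrite raddf_sum big1 //= => i _; rewrite -exprM mpolyXn mcoeffX.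
  case: eqP => // /(congr1 (@mdeg n)); rewrite mdegMn mdeg1 mdeg0 mul1n => /eqP.
  by rewrite muln_eq0 !eqn0Ngt r_gt0 k_gt0.
Qed.

(** This makes ['X_i * delta] annihilate all harmonic polynomials: the factor in parentheses acts on
    them as a multiple of the n-th power sum. *)
Lemma delta_factor (i : 'I_n) : exists a,
  'X_i * delta = a * (y i * \prod_(t in [set~ i]) (y i - y t)).
Proof.
pose F (a b : 'I_n) : S := y a - y b.
(* For a other than i, [G a] collects Vandermonde factors free of x_i; [sg] is the sign from
   reversing the factors y_a - y_i with a < i. *)
pose G (a : 'I_n) := \prod_(b < n | (a < b)%N && (b != i)) F a b.
pose lt_i := [pred a : 'I_n | (a != i) && (a < i)%N].
pose sg : S := \prod_(a | lt_i a) (-1).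
exists ((\prod_(a < n | a != i) 'X_a) ^+ r.-1 * (sg * \prod_(a < n | a != i) G a)).
have -> : \prod_(t in [set~ i]) (y i - y t) =
    \prod_(b < n | (i < b)%N) F i b * \prod_(a | lt_i a) F i a.
  rewrite (bigID (fun b : 'I_n => (i < b)%N)) /=; congr (_ * _); apply: eq_bigl => b.
    by rewrite !inE; case: eqVneq => //= ->; rewrite ltnn.
  by rewrite !inE -leqNgt leq_eqVlt (inj_eq val_inj); case: eqVneq.
rewrite /Defs.delta.
have -> : \prod_(a < n) \prod_(b < n | (a < b)%N) (y a - y b) =
    \prod_(b < n | (i < b)%N) F i b *
      (sg * \prod_(a | lt_i a) F i a * \prod_(a < n | a != i) G a).
  rewrite (bigD1 i) //=; congr (_ * _); rewrite -big_split big_mkcondr -big_split /=.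
  apply: eq_bigr => a nai; rewrite mulN1r opprB /G; case: ltnP => ai.
    by rewrite (bigD1 i).
  rewrite mul1r; apply: eq_bigl => b; case: eqVneq => [->|]; rewrite ?andbT //.
  by rewrite ltnNge ai.
rewrite (bigD1 i) //= exprMn !mulrA -exprS prednK //.
set u := _ ^+ r.-1; rewrite -!mulrA [LHS]mulrCA; congr (_ * _).
rewrite [X in _ * X]mulrCA [LHS]mulrCA; congr (_ * _).
by rewrite [RHS]mulrC -!mulrA.
Qed.

End Delta.

(** * Operators on superspace *)

Section OmegaOperators.
Variables (K : fieldType) (n : nat).
Local Notation S := {mpoly K[n]}.
Local Notation Om := (Omega K n).
Implicit Types (a b : S) (f g h x : Om) (A B U V : {set 'I_n}).
Local Notation theta := (@theta K n).

Lemma ofS_is_additive : additive (@ofS K n).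
Proof. by move=> a b; apply/ffunP => U; rewrite !ffunE; case: ifP; rewrite ?subr0. Qed.

HB.instance Definition _ := GRing.isAdditive.Build S Om (@ofS K n) ofS_is_additive.

(** Superspace is spanned by products of a polynomial and a word in the theta_i, so an identity only
    has to be propagated under left multiplication by generators. *)
Lemma Omega_ind (P : Om -> Prop) :
    P 1 -> (forall f g, P f -> P g -> P (f + g)) ->
    (forall a f, P f -> P (ofS a * f)) -> (forall i f, P f -> P (theta i * f)) ->
  forall f, P f.
Proof.
move=> P1 PD PS Pt f.
have P0 : P 0 by have := PS 0 1 P1; rewrite raddf0 mul0r.
have -> : f = \sum_(U : {set 'I_n}) ofS (f U) * \prod_(i in U) theta i.
  apply/ffunP => V; rewrite sum_ffunE (bigD1 V) //= [X in _ + X]big1 ?addr0 => [|U nUV].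
    by rewrite ofS_mull theta_prod !ffunE eqxx mulr1.
  by rewrite ofS_mull theta_prod !ffunE eq_sym (negbTE nUV) mulr0.
elim/big_rec: _ => // U g _; apply: PD; apply: PS.
by elim/big_rec: _ => // i x _; apply: Pt.
Qed.

Lemma ofSM a b : ofS (a * b) = ofS a * ofS b.
Proof.
by rewrite ofS_mull; apply/ffunP => U; rewrite !ffunE; case: ifP; rewrite ?mulr0.
Qed.

Lemma ofS1 : ofS 1 = 1 :> Om.
Proof. by apply/ffunP => U; rewrite !ffunE; case: eqP. Qed.

Lemma ofSZ (c : K) a : ofS (c *: a) = c *: ofS a.
Proof. by apply/ffunP => U; rewrite !ffunE; case: ifP; rewrite ?scaler0. Qed.

(** The grading involution; it carries the signs that arise when an odd element moves past [f], as
    in [mul_theta]. *)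
Definition parity f : Om := [ffun U : {set 'I_n} => (-1) ^+ #|U| *: f U].

Lemma parity_is_linear : linear parity.
Proof.
by move=> c f g; apply/ffunP => U; rewrite !ffunE scalerDr !scalerA mulrC.
Qed.

HB.instance Definition _ := GRing.isLinear.Build K Om Om _ parity parity_is_linear.

Lemma parityD f g : parity (f + g) = parity f + parity g.
Proof. exact: linearD. Qed.

Lemma dtheta_is_linear i : linear (@dtheta K n i).
Proof.
move=> c f g; apply/ffunP => U; rewrite !ffunE; case: ifP => _.
  by rewrite scaler0 addr0.
by rewrite mulrDr scalerAr.
Qed.

HB.instance Definition _ i :=
  GRing.isLinear.Build K Om Om _ (@dtheta K n i) (dtheta_is_linear i).

Definition pdO a f : Om := [ffun U => pd a (f U)].

Lemma pdO_is_linear a : linear (pdO a).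
Proof. by move=> c f g; apply/ffunP => U; rewrite !ffunE linearP. Qed.

HB.instance Definition _ a :=
  GRing.isLinear.Build K Om Om _ (pdO a) (pdO_is_linear a).

Lemma pdODl a b f : pdO (a + b) f = pdO a f + pdO b f.
Proof. by apply/ffunP => U; rewrite !ffunE pdDl. Qed.

Lemma pdO0l f : pdO 0 f = 0.
Proof. by apply/ffunP => U; rewrite !ffunE pd0l. Qed.

Lemma pdO1l f : pdO 1 f = f.
Proof. by apply/ffunP => U; rewrite !ffunE pd1l. Qed.

Lemma pdOM a b f : pdO (a * b) f = pdO a (pdO b f).
Proof. by apply/ffunP => U; rewrite !ffunE pdMl. Qed.

Lemma pdOZl c a f : pdO (c *: a) f = c *: pdO a f.
Proof. by apply/ffunP => U; rewrite !ffunE pdZl. Qed.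

Lemma pdO_suml (I : Type) (r : seq I) (P : pred I) (F : I -> S) f :
  pdO (\sum_(i <- r | P i) F i) f = \sum_(i <- r | P i) pdO (F i) f.
Proof. exact: (big_morph (pdO^~ f) (fun a b => pdODl a b f) (pdO0l f)). Qed.

Lemma sign_mulE k a : (-1) ^+ k * a = (-1) ^+ k *: a.
Proof. by rewrite -signr_odd mulr_sign -[in RHS]signr_odd scaler_sign. Qed.

Lemma dtheta_pdO i a f : dtheta i (pdO a f) = pdO a (dtheta i f).
Proof.
apply/ffunP => U; rewrite !ffunE; case: ifP => _; first by rewrite linear0.
by rewrite !sign_mulE linearZ.
Qed.

Lemma dtheta_ofS i a f : dtheta i (ofS a * f) = ofS a * dtheta i f.
Proof.
rewrite !ofS_mull; apply/ffunP => U; rewrite !ffunE; case: ifP => _.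
  by rewrite mulr0.
exact: mulrCA.
Qed.

Lemma dtheta_ofS1 i a : dtheta i (ofS a) = 0.
Proof.
apply/ffunP => U; rewrite !ffunE; case: ifP => // _.
by case: eqP => [/setP/(_ i)|]; rewrite ?mulr0 // !inE eqxx.
Qed.

Lemma dtheta1 i : dtheta i 1 = 0 :> Om.
Proof. by rewrite -ofS1 dtheta_ofS1. Qed.

Lemma card_ltS i j U : i != j -> j \notin U ->
  #|[set l in j |: U | (l < i)%N]| = (#|[set l in U | (l < i)%N]| + (j < i))%N.
Proof.
move=> nij jU; case: ltnP => ji /=.
  rewrite (_ : [set l in _ | _] = j |: [set l in U | (l < i)%N]).
    by rewrite cardsU1 inE (negbTE jU) addnC.
  by apply/setP => l; rewrite !inE; case: eqVneq => // ->.
rewrite addn0; apply: eq_card => l; rewrite !inE.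
by case: eqVneq => // ->; rewrite ltnNge ji /= andbF.
Qed.

(** The canonical anticommutation relation. For distinct i and j the sign exponents of the two
    orders differ by one, since exactly one of i < j and j < i holds. *)
Lemma dtheta_thetaC i j f :
  dtheta i (theta j * f) = (i == j)%:R *: f - theta j * dtheta i f.
Proof.
have [->|nij] := eqVneq i j.
  by rewrite scale1r -[X in X - _](dtheta_theta j f) addrK.
rewrite scale0r sub0r !theta_mull; apply/ffunP => U; rewrite !ffunE !inE.
rewrite [j == i]eq_sym (negbTE nij) /=.
case: (boolP (i \in U)) => iU; first by case: ifP; rewrite ?mulr0 ?oppr0.
case: (boolP (j \in U)) => jU; last by rewrite mulr0 oppr0.
have -> : (i |: U) :\ j = i |: U :\ j.
  by apply/setP => l; rewrite !inE; case: (eqVneq l j) => // ->; rewrite eq_sym (negbTE nij).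
have -> : #|[set l in U | (l < i)%N]| = (#|[set l in U :\ j | (l < i)%N]| + (j < i))%N.
  by rewrite -[in LHS](setD1K jU) card_ltS ?setD11.
rewrite card_ltS 1?eq_sym // !sign_mulE !scalerA -!exprD -scaleNr.
congr (_ *: _); rewrite -[RHS]mulN1r -exprS; congr (_ ^+ _).
have := nij; rewrite -(inj_eq val_inj) /=.
by case: ltngtP => //= _ _; rewrite !(addn0, addn1) ?(addSn, addnS) addnC.
Qed.

Lemma dthetaC i j f : dtheta i (dtheta j f) = - dtheta j (dtheta i f).
Proof.
elim/Omega_ind: f => [|f g IHf IHg|a f IHf|l f IHf].
- by rewrite !dtheta1 !linear0.
- by rewrite !linearD /= IHf IHg.
- by rewrite !dtheta_ofS IHf mulrN.
rewrite !dtheta_thetaC !linearB !linearZ /= !dtheta_thetaC IHf mulrN.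
by rewrite !opprK scalerN opprD addrCA.
Qed.

Lemma dtheta_sq i f : dtheta i (dtheta i f) = 0.
Proof.
apply/ffunP => U; rewrite !ffunE; case: ifP => // _.
by rewrite setU11 mulr0.
Qed.

Lemma parity_ofS a f : parity (ofS a * f) = ofS a * parity f.
Proof. by rewrite !ofS_mull; apply/ffunP => U; rewrite !ffunE scalerAr. Qed.

Lemma parity1 : parity 1 = 1.
Proof.
rewrite -ofS1; apply/ffunP => U; rewrite !ffunE; case: eqP => [->|].
  by rewrite cards0 scale1r.
by rewrite scaler0.
Qed.

Lemma parity_theta i f : parity (theta i * f) = - (theta i * parity f).
Proof.
rewrite !theta_mull; apply/ffunP => U; rewrite !ffunE; case: ifP => iU.
  rewrite !sign_mulE !scalerA -scaleNr (cardsD1 i U) iU add1n exprS mulN1r.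
  by rewrite mulNr mulrC.
by rewrite scaler0 oppr0.
Qed.

Lemma parity_dtheta i f : parity (dtheta i f) = - dtheta i (parity f).
Proof.
apply/ffunP => U; rewrite !ffunE; case: ifP => iU; first by rewrite scaler0 oppr0.
rewrite !sign_mulE !scalerA -scaleNr cardsU1 iU add1n exprS mulN1r.
by rewrite mulrN opprK mulrC.
Qed.

Lemma parity_pdO a f : parity (pdO a f) = pdO a (parity f).
Proof. by apply/ffunP => U; rewrite !ffunE linearZ. Qed.

Lemma parityM f g : parity (f * g) = parity f * parity g.
Proof.
elim/Omega_ind: f => [|f f' IHf IHf'|a f IHf|l f IHf].
- by rewrite parity1 !mul1r.
- by rewrite mulrDl !linearD /= IHf IHf' mulrDl.
- by rewrite -mulrA !parity_ofS IHf mulrA.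
- by rewrite -mulrA !parity_theta IHf mulrA mulNr.
Qed.

Lemma mul_theta i f : f * theta i = theta i * parity f.
Proof.
elim/Omega_ind: f => [|f f' IHf IHf'|a f IHf|l f IHf].
- by rewrite parity1 mulr1 mul1r.
- by rewrite mulrDl linearD /= IHf IHf' mulrDr.
- by rewrite -mulrA IHf parity_ofS !mulrA [theta i * ofS a]ofS_comm.
- by rewrite -mulrA IHf parity_theta mulrA theta_anticomm mulNr mulrN mulrA.
Qed.

Lemma enumU1 i A : i \notin A ->
  let s1 := [seq j : 'I_n <- enum A | (j < i)%N] in
  let s2 := [seq j : 'I_n <- enum A | (i < j)%N] in
  enum A = s1 ++ s2 /\ enum (i |: A) = s1 ++ i :: s2.
Proof.
move=> iA s1 s2.
pose ltI := [rel j k : 'I_n | (j < k)%N].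
have tr : transitive ltI by move=> b a c; apply: ltn_trans.
have irr : irreflexive ltI by move=> a; apply: ltnn.
have sE (B : {set 'I_n}) : sorted ltI (enum B).
  rewrite /enum_mem -enumT; apply: sorted_filter => //.
  by have := iota_ltn_sorted 0 n; rewrite -val_enum_ord sorted_map.
have mem1 j : (j \in s1) = (j \in A) && (j < i)%N.
  by rewrite mem_filter mem_enum andbC.
have mem2 j : (j \in s2) = (j \in A) && (i < j)%N.
  by rewrite mem_filter mem_enum andbC.
have pw1 : pairwise ltI s1 by rewrite -sorted_pairwise //; apply: sorted_filter.
have pw2 : pairwise ltI s2 by rewrite -sorted_pairwise //; apply: sorted_filter.
split; apply: (irr_sorted_eq tr irr) => //.
- rewrite sorted_pairwise // pairwise_cat pw1 pw2 !andbT.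
  apply/allrelP => j k; rewrite mem1 mem2 => /andP[_ ji] /andP[_].
  exact: ltn_trans.
- move=> j; rewrite mem_cat mem1 mem2 mem_enum -andb_orr.
  by case: ltngtP => [||/val_inj ji]; rewrite ?andbT // ji (negbTE iA).
- rewrite sorted_pairwise // pairwise_cat pw1 /= pw2 andbT; apply/andP; split.
    apply/allrelP => j k; rewrite mem1 inE mem2 => /andP[_ ji].
    by case/predU1P => [->//|/andP[_]]; apply: ltn_trans.
  by apply/allP => j; rewrite mem2 => /andP[].
- move=> j; rewrite mem_cat inE mem1 mem2 mem_enum !inE orbCA -andb_orr.
  case: eqVneq => //= nji; rewrite -neq_ltn.
  by rewrite (inj_eq val_inj) nji andbT.
Qed.

(* [theta_sum H op x] is \sum_A f_A op_a1 (... (op_ak x)), where H interprets the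
   coefficients and op the anticommuting variables; both [odot] and [act] have
   this form. *)
Definition theta_sum (H : S -> Om -> Om) (op : 'I_n -> Om -> Om) x f : Om :=
  \sum_(A : {set 'I_n}) H (f A) (foldr op x (enum A)).

Section ThetaSum.
Variables (H : S -> Om -> Om) (op : 'I_n -> Om -> Om) (x : Om).
Hypotheses (HDl : forall a b f, H (a + b) f = H a f + H b f)
  (HZl : forall c a f, H (c *: a) f = c *: H a f)
  (HZr : forall a c f, H a (c *: f) = c *: H a f)
  (HDr : forall a f g, H a (f + g) = H a f + H a g)
  (HM : forall a b f, H (a * b) f = H a (H b f))
  (H1 : forall f, H 1 f = f)
  (opD : forall i f g, op i (f + g) = op i f + op i g)
  (opZ : forall i c f, op i (c *: f) = c *: op i f)
  (opC : forall i j f, op i (op j f) = - op j (op i f))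
  (op_sq : forall i f, op i (op i f) = 0)
  (opH : forall i a f, op i (H a f) = H a (op i f)).

Let op0 i : op i 0 = 0.
Proof. by have := opZ i 0 0; rewrite !scale0r. Qed.

Let H0l f : H 0 f = 0.
Proof. by have := HZl 0 0 f; rewrite !scale0r. Qed.

Let H0r a : H a 0 = 0.
Proof. by have := HZr a 0 0; rewrite !scale0r. Qed.

Lemma foldr_op_insert (i : 'I_n) s1 s2 :
  op i (foldr op x (s1 ++ s2)) = (-1) ^+ size s1 *: foldr op x (s1 ++ i :: s2).
Proof.
elim: s1 => [|j s1 IHs] /=; first by rewrite scale1r.
by rewrite opC IHs opZ exprS mulN1r scaleNr.
Qed.

Lemma op_foldr_enum i A : op i (foldr op x (enum A)) =
  if i \in A then 0
  else (-1) ^+ #|[set j in A | (j < i)%N]| *: foldr op x (enum (i |: A)).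
Proof.
case: ifPn => iA.
  rewrite -(setD1K iA); have [_ ->] := enumU1 (negbT (setD11 i A)).
  set s1 := filter _ _; set s2 := filter _ _.
  elim: s1 => [|j s1 IHs] /=; first exact: op_sq.
  by rewrite opC IHs op0 oppr0.
have [eA ->] := enumU1 iA; rewrite {1}eA foldr_op_insert; congr ((-1) ^+ _ *: _).
rewrite cardE; apply/perm_size/uniq_perm => [||j].
- exact/filter_uniq/enum_uniq.
- exact: enum_uniq.
- by rewrite mem_filter !mem_enum inE andbC.
Qed.

(** Adding i to A matches the two sums, and the sign of sorting i into place is the one in
    [theta_mull]. With [theta_sum_ofS], this lets [odot] and [act] be computed one generator at a
    time. *)
Lemma theta_sum_theta i f :
  theta_sum H op x (theta i * f) = op i (theta_sum H op x f).
Proof.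
rewrite /theta_sum (big_morph (op i) (opD i) (op0 i)).
under [LHS]eq_bigr => A _ do rewrite theta_mull ffunE.
under [RHS]eq_bigr => A _ do rewrite opH op_foldr_enum.
rewrite (bigID (fun A => i \in A)) /= [X in _ + X]big1 ?addr0; last first.
  by move=> A /negbTE ->; rewrite H0l.
rewrite [RHS](bigID (fun A => i \in A)) /= [X in _ = X + _]big1 ?add0r; last first.
  by move=> A ->; rewrite H0r.
rewrite (reindex_onto (fun A => i |: A) (fun A => A :\ i)) /=; last first.
  by move=> A iA; rewrite setD1K.
apply: eq_big => [A|A /andP[_ /eqP iA]].
  rewrite setU11 /=; apply/eqP/idP => [<-|iA]; first by rewrite setD11.
  exact: setU1K.
have {}iA : i \notin A by rewrite -iA setD11.
rewrite setU11 setU1K // (negbTE iA) sign_mulE HZl HZr.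
congr ((-1) ^+ _ *: _); apply: eq_card => j; rewrite !inE.
by case: eqVneq => // ->; rewrite ltnn /= andbF.
Qed.

Lemma theta_sum_ofS a f :
  theta_sum H op x (ofS a * f) = H a (theta_sum H op x f).
Proof.
rewrite /theta_sum (big_morph (H a) (HDr a) (H0r a)).
by apply: eq_bigr => A _; rewrite ofS_mull ffunE HM.
Qed.

Lemma theta_sumD f g :
  theta_sum H op x (f + g) = theta_sum H op x f + theta_sum H op x g.
Proof. by rewrite -big_split; apply: eq_bigr => A _; rewrite ffunE HDl. Qed.

Lemma theta_sum1 : theta_sum H op x 1 = x.
Proof.
rewrite -ofS1 /theta_sum (bigD1 set0) //= big1 ?addr0 => [|A nA].
  by rewrite ffunE eqxx H1 enum_set0.
by rewrite ffunE (negbTE nA) H0l.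
Qed.

End ThetaSum.

End OmegaOperators.

(** * The action of superspace on itself and the Euler operators *)

Section OdotAct.
Variables (K : fieldType) (n : nat).
Local Notation S := {mpoly K[n]}.
Local Notation Om := (Omega K n).
Implicit Types (a b : S) (f g h : Om) (U V : {set 'I_n}) (A : 'M[K]_n).
Local Notation theta := (@theta K n).
Local Notation dtheta := (@dtheta K n).

Lemma odotE f g : odot f g = theta_sum (@pdO K n) dtheta g f.
Proof.
apply: eq_bigr => A _; apply/ffunP => U; rewrite ffunE /pd sum_ffunE.
by apply: eq_bigr => m _; rewrite !ffunE.
Qed.

Lemma odot1 g : odot 1 g = g.
Proof.
rewrite odotE theta_sum1 //; [exact: pdOZl | exact: pdO1l].
Qed.

Lemma odotDl f f' g : odot (f + f') g = odot f g + odot f' g.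
Proof. by rewrite !odotE theta_sumD //; apply: pdODl. Qed.

Lemma odot0l g : odot 0 g = 0.
Proof. by rewrite odotE /theta_sum big1 // => A _; rewrite ffunE pdO0l. Qed.

Lemma odotBl f f' g : odot (f - f') g = odot f g - odot f' g.
Proof. by apply/eqP; rewrite -subr_eq opprK -odotDl subrK. Qed.

Lemma odot_ofS a f g : odot (ofS a * f) g = pdO a (odot f g).
Proof.
rewrite !odotE theta_sum_ofS // => *; by [rewrite linearZ|rewrite linearD|rewrite pdOM].
Qed.

Lemma odot_theta i f g : odot (theta i * f) g = dtheta i (odot f g).
Proof.
rewrite !odotE theta_sum_theta // => *.
- exact: pdOZl.
- by rewrite linearZ.
- by rewrite linearD.
- by rewrite linearZ.
- exact: dthetaC.
- exact: dtheta_sq.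
- exact: dtheta_pdO.
Qed.

Lemma odot_is_linear f : linear (odot f).
Proof.
move=> c g h; elim/Omega_ind: f => [|f f' IHf IHf'|a f IHf|i f IHf].
- by rewrite !odot1.
- by rewrite !odotDl IHf IHf' scalerDr addrACA.
- by rewrite !odot_ofS IHf linearP.
- by rewrite !odot_theta IHf linearP.
Qed.

HB.instance Definition _ f :=
  GRing.isLinear.Build K Om Om _ (odot f) (odot_is_linear f).

Lemma odot_pdO f a g : odot f (pdO a g) = pdO a (odot f g).
Proof.
elim/Omega_ind: f => [|f f' IHf IHf'|b f IHf|i f IHf].
- by rewrite !odot1.
- by rewrite !odotDl IHf IHf' linearD.
- by rewrite !odot_ofS IHf -!pdOM mulrC.
- by rewrite !odot_theta IHf dtheta_pdO.
Qed.

Lemma dxE i f : dx i f = pdO 'X_i f.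
Proof. by apply/ffunP => U; rewrite !ffunE pdX. Qed.

Lemma iter_dxE k i f : iter k (dx i) f = pdO ('X_i ^+ k) f.
Proof.
elim: k => [|k IHk] /=; first by rewrite pdO1l.
by rewrite IHk dxE -pdOM -exprS.
Qed.

Lemma eulerE k f : euler k f = \sum_i theta i * parity (pdO ('X_i ^+ k) f).
Proof. by apply: eq_bigr => i _; rewrite iter_dxE mul_theta. Qed.

Lemma euler_is_linear k : linear (@euler K n k).
Proof.
move=> c f g; rewrite !eulerE scaler_sumr -big_split /=; apply: eq_bigr => i _.
by rewrite !linearP /= mulrDr scalerAr.
Qed.

HB.instance Definition _ k :=
  GRing.isLinear.Build K Om Om _ (@euler K n k) (euler_is_linear k).

(** The S-linear odd derivation sending theta_i to x_i^k; by [odot_euler] it measures how far [odot]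
    is from commuting with [euler k]. *)
Definition contraction k f : Om := \sum_i ofS ('X_i ^+ k) * dtheta i f.

Lemma contraction_is_linear k : linear (contraction k).
Proof.
move=> c f g; rewrite /contraction scaler_sumr -big_split /=; apply: eq_bigr => i _.
by rewrite !linearP /= mulrDr scalerAr.
Qed.

HB.instance Definition _ k :=
  GRing.isLinear.Build K Om Om _ (contraction k) (contraction_is_linear k).

Lemma contractionD k f g :
  contraction k (f + g) = contraction k f + contraction k g.
Proof. exact: linearD. Qed.

Lemma contraction1 k : contraction k 1 = 0.
Proof. by rewrite /contraction big1 // => i _; rewrite dtheta1 mulr0. Qed.

Lemma contraction_ofS k a f : contraction k (ofS a * f) = ofS a * contraction k f.
Proof.
rewrite /contraction mulr_sumr; apply: eq_bigr => i _.
by rewrite dtheta_ofS !mulrA -!ofSM mulrC.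
Qed.

Lemma contraction_theta k i f :
  contraction k (theta i * f) = ofS ('X_i ^+ k) * f - theta i * contraction k f.
Proof.
rewrite /contraction mulr_sumr -[X in _ = X - _](big_pred1_eq +%R i (fun i => ofS ('X_i ^+ k) * f)).
rewrite big_mkcond -sumrB; apply: eq_bigr => j _; rewrite dtheta_thetaC mulrBr.
rewrite !mulrA [theta i * _]ofS_comm; congr (_ - _).
by case: eqVneq => [->|_]; rewrite ?scale1r ?scale0r ?mulr0.
Qed.

Lemma contractionM k f g :
  contraction k (f * g) = contraction k f * g + parity f * contraction k g.
Proof.
elim/Omega_ind: f => [|f f' IHf IHf'|a f IHf|i f IHf].
- by rewrite contraction1 parity1 mul0r add0r !mul1r.
- by rewrite mulrDl !linearD /= IHf IHf' !mulrDl addrACA.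
- by rewrite -mulrA !contraction_ofS parity_ofS IHf mulrDr !mulrA.
rewrite -mulrA !contraction_theta parity_theta IHf mulrDr mulrBl mulNr opprD.
by rewrite !mulrA addrA.
Qed.

Lemma dtheta_euler k i h :
  dtheta i (euler k h) = euler k (dtheta i h) + parity (pdO ('X_i ^+ k) h).
Proof.
rewrite !eulerE linear_sum /= addrC.
rewrite -(big_pred1_eq +%R i (fun i => parity (pdO ('X_i ^+ k) h))) big_mkcond.
rewrite -big_split; apply: eq_bigr => j _ /=; rewrite dtheta_thetaC; congr (_ + _).
  by rewrite eq_sym; case: eqVneq => [->|_]; rewrite ?scale1r ?scale0r.
by rewrite -dtheta_pdO parity_dtheta mulrN.
Qed.

(** By induction on generators: differentiation in the x_i commutes with [euler k], and the
    correction term of [dtheta_euler] matches the first term of [contraction_theta]. *)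
Lemma odot_euler k f g :
  odot f (euler k g) = euler k (odot f g) + parity (odot (contraction k f) g).
Proof.
have pe a u : pdO a (euler k u) = euler k (pdO a u).
  rewrite !eulerE linear_sum; apply: eq_bigr => i _ /=.
  rewrite -pdOM [_ * a]mulrC pdOM [in RHS]parity_pdO; move: (parity _) => v.
  apply/ffunP => U; rewrite !(theta_mull, ffunE); case: ifP => _; last by rewrite linear0.
  by rewrite !sign_mulE linearZ.
elim/Omega_ind: f => [|f f' IHf IHf'|a f IHf|i f IHf].
- by rewrite !odot1 contraction1 odot0l linear0 addr0.
- by rewrite !linearD /= !odotDl IHf IHf' !linearD addrACA.
- by rewrite contraction_ofS !odot_ofS IHf linearD /= pe -parity_pdO.
rewrite contraction_theta !odot_theta IHf linearD /= dtheta_euler -addrA.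
by rewrite odotBl odot_theta odot_ofS linearB /= parity_dtheta opprK.
Qed.

End OdotAct.

(** * The group action and its compatibility with contraction *)

Section InvariantIdeal.
Variables (K : numClosedFieldType) (n r : nat).
Hypothesis r_gt0 : (0 < r)%N.
Local Notation S := {mpoly K[n]}.
Local Notation Om := (Omega K n).
Implicit Types (a b p : S) (f g h : Om) (U V : {set 'I_n}) (A : 'M[K]_n).
Local Notation theta := (@theta K n).
Local Notation subst A p := (p \mPo [tuple act_x A i | i < n]).

Lemma theta_lin_anticomm (c d : 'I_n -> K) :
  (\sum_i c i *: theta i) * (\sum_i d i *: theta i) =
  - ((\sum_i d i *: theta i) * (\sum_i c i *: theta i)).
Proof.
rewrite mulr_suml [in RHS]mulr_suml.
under eq_bigr do rewrite mulr_sumr; under [in RHS]eq_bigr do rewrite mulr_sumr.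
rewrite exchange_big /= -sumrN; apply: eq_bigr => i _.
rewrite -sumrN; apply: eq_bigr => j _.
by rewrite -!scalerAl -!scalerAr theta_anticomm !scalerN !scalerA mulrC.
Qed.

Lemma act_theta_sq A i : act_theta A i * act_theta A i = 0.
Proof.
have /eqP := theta_lin_anticomm (fun j => (A j i)^-1) (fun j => (A j i)^-1).
rewrite -addr_eq0 -mulr2n -scaler_nat scaler_eq0 Num.Theory.pnatr_eq0 /=.
by move/eqP.
Qed.

Lemma actE A f : act A f =
  theta_sum (fun a h => ofS (subst A a) * h) (fun i h => act_theta A i * h) 1 f.
Proof.
apply: eq_bigr => U _; congr (_ * _); rewrite -big_filter [index_enum _]unlock -enumT.
rewrite [in RHS]/enum_mem -enumT.
by elim: (filter _ _) => [|i s IHs]; rewrite ?big_nil // big_cons IHs.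
Qed.

Lemma act_mul_ofS A a f : act A (ofS a * f) = ofS (subst A a) * act A f.
Proof.
rewrite !actE theta_sum_ofS // => *; by rewrite ?scalerAr ?mulrDr ?rmorphM ?ofSM ?mulrA.
Qed.

Lemma act_mul_theta A i f : act A (theta i * f) = act_theta A i * act A f.
Proof.
rewrite !actE theta_sum_theta // => *.
- by rewrite comp_mpolyZ ofSZ scalerAl.
- by rewrite scalerAr.
- by rewrite mulrDr.
- by rewrite scalerAr.
- by rewrite !mulrA theta_lin_anticomm mulNr.
- by rewrite mulrA act_theta_sq mul0r.
- by rewrite !mulrA ofS_comm.
Qed.

Lemma actD A f g : act A (f + g) = act A f + act A g.
Proof. by rewrite !actE theta_sumD // => *; rewrite rmorphD raddfD mulrDl. Qed.

Lemma actB A f g : act A (f - g) = act A f - act A g.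
Proof. by apply/eqP; rewrite -subr_eq opprK -actD subrK. Qed.

Lemma act1 A : act A 1 = 1.
Proof.
rewrite actE theta_sum1 // => *; first by rewrite comp_mpolyZ ofSZ scalerAl.
by rewrite rmorph1 ofS1 mul1r.
Qed.

Lemma parity_theta1 i : parity (theta i) = - theta i.
Proof. by rewrite -[theta i]mulr1 parity_theta parity1. Qed.

Lemma parity_act A f : parity (act A f) = act A (parity f).
Proof.
have pt i : parity (act_theta A i) = - act_theta A i.
  rewrite linear_sum -sumrN; apply: eq_bigr => j _.
  by rewrite linearZ /= parity_theta1 scalerN.
have a0 : act A 0 = 0 by rewrite -[X in act A X](subrr (1 : Om)) actB subrr.
have aN u : act A (- u) = - act A u by rewrite -[- u]sub0r actB a0 sub0r.
elim/Omega_ind: f => [|f f' IHf IHf'|a f IHf|i f IHf].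
- by rewrite parity1 act1 parity1.
- by rewrite parityD actD actD parityD (congr2 +%R IHf IHf').
- by rewrite parity_ofS !act_mul_ofS parity_ofS IHf.
- by rewrite parity_theta aN !act_mul_theta parityM pt IHf mulNr.
Qed.

Lemma wreath_monomial A : wreath r A -> exists (w : {perm 'I_n}) (c : 'I_n -> K),
  forall i, [/\ c i ^+ r = 1, act_x A i = c i *: 'X_(w i) &
                act_theta A i = c i *: theta (w i)].
Proof.
move=> [rowA colA Ar].
have /fin_all_exists[w wP] i : exists j, A j i != 0 /\ forall j', A j' i != 0 -> j' = j.
  by have [j [Aj ju]] := colA i; exists j; split=> // j' /ju.
have w_inj : injective w.
  move=> i j wij; have [k [_ ku]] := rowA (w i).
  rewrite -(ku i); last by case: (wP i).
  by apply: ku; rewrite wij; case: (wP j).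
exists (perm w_inj), (fun i => (A (w i) i)^-1) => i.
have [Awi wu] := wP i.
have A0 j : j != w i -> A j i = 0 by apply: contraNeq => /wu ->.
rewrite permE; split; first by rewrite exprVn Ar // invr1.
  rewrite /act_x (bigD1 (w i)) //= big1 ?addr0 // => j /A0 ->.
  by rewrite invr0 scale0r.
rewrite /act_theta (bigD1 (w i)) //= big1 ?addr0 // => j /A0 ->.
by rewrite invr0 scale0r.
Qed.

Lemma expr_unityD (c : K) k : c ^+ r = 1 -> c ^+ (k * r + 1) = c.
Proof. by move=> cr; rewrite exprD mulnC exprM cr expr1n mul1r expr1. Qed.

(** If c^r = 1 then c^(kr+1) = c, so x_i^(kr+1) is permuted and scaled by the group exactly as
    theta_i is. *)
Lemma contraction_act k A f : wreath r A ->
  contraction (k * r + 1) (act A f) = act A (contraction (k * r + 1) f).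
Proof.
move=> /wreath_monomial[w [c cP]]; set d := (k * r + 1)%N.
have ct i : contraction d (theta i) = ofS ('X_i ^+ d).
  by rewrite -[theta i]mulr1 contraction_theta contraction1 mulr0 subr0 mulr1.
elim/Omega_ind: f => [|f f' IHf IHf'|a f IHf|i f IHf].
- by rewrite act1 contraction1 -[X in act A X](subrr (1 : Om)) actB subrr.
- by rewrite contractionD actD actD contractionD (congr2 +%R IHf IHf').
- by rewrite contraction_ofS !act_mul_ofS contraction_ofS IHf.
have [cr ax at_] := cP i.
rewrite contraction_theta act_mul_theta actB act_mul_ofS act_mul_theta.
rewrite contractionM -IHf rmorphXn /= comp_mpolyXU -tnth_nth tnth_mktuple ax at_.
rewrite !linearZ /= ct parity_theta1 exprZn expr_unityD // ofSZ.
by rewrite scalerN mulNr.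
Qed.

Lemma mul_set0 f g : (f * g) set0 = f set0 * g set0.
Proof.
rewrite [f * g]/(omega_mul f g) ffunE (big_pred1 set0) => [|U].
  by rewrite inversions0l set0D mul1r.
by rewrite subset0.
Qed.

Lemma theta_set0 i : theta i set0 = 0.
Proof. by rewrite ffunE; case: eqP => // /setP/(_ i); rewrite !inE eqxx. Qed.

Lemma act_set0 A f : act A f set0 = subst A (f set0).
Proof.
elim/Omega_ind: f => [|f f' IHf IHf'|a f IHf|i f IHf].
- by rewrite act1 -ofS1 ffunE eqxx rmorph1.
- by rewrite actD [LHS]ffunE (congr2 +%R IHf IHf') [in RHS]ffunE rmorphD.
- by rewrite act_mul_ofS !mul_set0 IHf rmorphM !ffunE eqxx.
rewrite act_mul_theta !mul_set0 theta_set0 mul0r rmorph0 sum_ffunE big1 ?mul0r //.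
by move=> j _; rewrite ffunE theta_set0 scaler0.
Qed.

End InvariantIdeal.

(** * Closure of the inverse system under the operators *)

Section InverseSystemClosed.
Variables (K : numClosedFieldType) (n r : nat).
Hypothesis r_gt0 : (0 < r)%N.
Local Notation S := {mpoly K[n]}.
Local Notation Om := (Omega K n).
Implicit Types (a b p : S) (f g h : Om) (U V : {set 'I_n}) (A : 'M[K]_n).
Local Notation delta := (delta K n r).
Local Notation SI := (@SI K n r).

Lemma prim_root_exists : exists z : K, r.-primitive_root z.
Proof.
have [zs Dp] := closed_field_poly_normal ('X^r - 1 : {poly K}).
rewrite (monicP _) ?monicXnsubC // scale1r in Dp.
have rn1 : all r.-unity_root zs by apply/allP=> z; rewrite -root_prod_XsubC -Dp.
have szs : (r < (size zs).+1)%N.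
  by rewrite -(size_prod_XsubC zs id) -Dp size_XnsubC.
have [|z] := hasP (has_prim_root r_gt0 rn1 _ szs); last by exists z.
rewrite -separable_prod_XsubC -Dp.
by rewrite separable_Xn_sub_1 // Num.Theory.pnatr_eq0 -lt0n.
Qed.

Lemma wreath_perm (w : {perm 'I_n}) : wreath r (\matrix_(j, k) (j == w k)%:R : 'M[K]_n).
Proof.
have nz (j k : 'I_n) : ((j == w k)%:R != 0 :> K) = (j == w k).
  by case: (j == w k); rewrite ?oner_eq0 ?eqxx.
split=> [j|k|j k]; last by rewrite !mxE nz => ->; rewrite expr1n.
  exists ((w^-1)%g j); split; rewrite ?mxE ?nz ?permKV // => k.
  by rewrite mxE nz => /eqP ->; rewrite permK.
by exists (w k); split=> [|j]; rewrite mxE nz // => /eqP.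
Qed.

Lemma wreath_diag (d : 'rV[K]_n) : (forall i, d 0 i ^+ r = 1) -> wreath r (diag_mx d).
Proof.
move=> dr; have nz (j k : 'I_n) : (diag_mx d j k != 0) = (j == k).
  rewrite mxE; case: (eqVneq j k) => [->|_]; last by rewrite mulr0n eqxx.
  rewrite mulr1n.
  apply/eqP => d0; have := dr k; rewrite d0 expr0n eqn0Ngt r_gt0 => /eqP.
  by rewrite eq_sym oner_eq0.
split=> [j|k|j k]; last by rewrite nz => /eqP ->; rewrite mxE eqxx mulr1n.
  by exists j; split=> [|k]; rewrite nz // => /eqP.
by exists k; split=> [|j]; rewrite nz // => /eqP.
Qed.

Lemma msymE_comp (w : {perm 'I_n}) p : msym w p = p \mPo [tuple 'X_(w i) | i < n].
Proof.
elim/mpoly_ring_ind: p => [|c f IHf|f g IHf IHg|i f IHf].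
- by rewrite !rmorph1.
- by rewrite msymZ comp_mpolyZ IHf.
- by rewrite !raddfD /= IHf IHg.
- by rewrite !rmorphM /= IHf msym_Xi comp_mpolyXU -tnth_nth tnth_mktuple.
Qed.

Lemma mcoeff_comp_scale (c : 'I_n -> K) p m :
  (p \mPo [tuple c i *: 'X_i | i < n])@_m = (\prod_i c i ^+ m i) * p@_m.
Proof.
rewrite comp_mpolyEX raddf_sum [p in RHS]mpolyE raddf_sum mulr_sumr.
apply: eq_bigr => k _ /=; rewrite !mcoeffZ mulrCA; congr (_ * _).
rewrite comp_mpolyX (eq_bigr (fun i => c i ^+ k i *: 'X_i ^+ k i)) => [|i _]; last first.
  by rewrite tnth_mktuple exprZn.
rewrite scaler_prod mcoeffZ -mpolyXE_id !mcoeffX.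
by case: eqP => [->|]; rewrite ?mulr0.
Qed.

(** The theta-free component is invariant by itself ([act_set0]). Transposition matrices give the
    symmetry, and a diagonal matrix with a primitive r-th root of unity in one place gives the
    divisibility. *)
Lemma invariant_set0 f : Defs.invariant r f ->
  (forall i j, msym (tperm i j) (f set0) = f set0) /\
  (forall m, m \in msupp (f set0) -> forall i, (r %| m i)%N).
Proof.
move=> invf; split=> [i j|m fm i].
  rewrite -[in RHS](invf _ (wreath_perm (tperm i j))) act_set0 msymE_comp.
  congr (_ \mPo _); apply: eq_from_tnth => k; rewrite !tnth_mktuple.
  by rewrite (act_x_perm (w := tperm i j)) // => l k'; rewrite mxE.
have [z zP] := prim_root_exists.
pose d : 'rV[K]_n := \row_k if k == i then z else 1.
have dW : wreath r (diag_mx d).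
  apply: wreath_diag => k; rewrite mxE.
  by case: ifP; rewrite ?expr1n // (prim_expr_order zP).
have := congr1 (mcoeff m) (act_set0 (diag_mx d) f); rewrite invf //.
have -> : [tuple act_x (diag_mx d) i | i < n] = [tuple (d 0 i)^-1 *: 'X_i | i < n].
  by apply: eq_from_tnth => k; rewrite !tnth_mktuple act_x_diag.
rewrite mcoeff_comp_scale -[LHS]mul1r => /mulIf; rewrite -mcoeff_msupp => /(_ fm).
rewrite (bigD1 i) //= big1 => [|k nki]; last by rewrite mxE (negbTE nki) invr1 expr1n.
rewrite mulr1 mxE eqxx exprVn (prim_order_dvd zP) => /(congr1 GRing.inv).
by rewrite invrK invr1 => ->.
Qed.

Lemma SI_ideal : is_ideal SI.
Proof.
split=> [I [I0 _ _] _ //|f g If Ig I I_id gen|a f b If I I_id gen].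
  by case: (I_id) => _ ID _; apply: ID; [apply: If|apply: Ig].
by case: (I_id) => _ _ IM; apply: IM; apply: If.
Qed.

Lemma SI_gen f : Defs.invariant r f -> (f set0)@_0 = 0 -> SI f.
Proof. by move=> invf f0 I _; apply. Qed.

Lemma SI_parity_contraction k f : SI f ->
  SI (parity f) /\ SI (contraction (k * r + 1) f).
Proof.
move=> SIf; have [SI0 SID SIM] := SI_ideal.
(* These conditions define an ideal because [contraction] is an odd derivation. The generators
   satisfy them because [parity] and [contraction] preserve invariance and produce no constant
   term. *)
pose I f := [/\ SI f, SI (parity f) & SI (contraction (k * r + 1) f)].
suff [] : I f by [].
apply: SIf => [|{}f [invf f0]].
  split=> [|f' g [If Ief Icf] [Ig Ieg Icg]|a f' b [If Ief Icf]].
  - by split; rewrite ?linear0.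
  - by split; rewrite ?linearD; apply: SID.
  split; first exact: SIM.
    by rewrite !parityM; apply: SIM.
  rewrite !contractionM mulrDl parityM.
  by apply: (SID); [apply: (SID)|]; apply: SIM.
split; first exact: SI_gen.
  apply: SI_gen => [A wA|]; first by rewrite -parity_act invf.
  by rewrite ffunE cards0 scale1r.
apply: SI_gen => [A wA|]; first by rewrite -contraction_act // invf.
rewrite sum_ffunE raddf_sum big1 //= => i _; rewrite mul_set0 ffunE eqxx.
rewrite rmorphM /= mpolyXn mcoeffX.
case: eqP => [/(congr1 (@mdeg n))|_]; last by rewrite mul0r.
by rewrite mdegMn mdeg1 mdeg0 mul1n addn1.
Qed.

Lemma inverse_system_closed : operator_closed r (inverse_system SI).
Proof.
split=> [|f SIf|i g Ig f SIf|k g _ Ig f SIf].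
- split=> [f _|c f g If Ig h SIh]; first by rewrite linear0.
  by rewrite linearP /= If // Ig // scaler0 addr0.
(* A polynomial is killed by every [dtheta i], so only the theta-free component of [f] acts on it,
   and [pd_delta_invariant] settles the generators. *)
- have odS p : odot f (ofS p) = ofS (pd (f set0) p).
    elim/Omega_ind: (f) => [|f1 f2 IH1 IH2|a f1 IH1|i f1 IH1].
    + by rewrite odot1 -ofS1 ffunE eqxx pd1l.
    + by rewrite odotDl IH1 IH2 ffunE pdDl raddfD.
    + rewrite odot_ofS IH1 mul_set0 [ofS a set0]ffunE eqxx pdMl.
      by apply/ffunP => U; rewrite !ffunE; case: ifP; rewrite ?linear0.
    + by rewrite odot_theta IH1 dtheta_ofS1 mul_set0 theta_set0 mul0r pd0l raddf0.
  rewrite odS; suff -> : pd (f set0) delta = 0 by rewrite raddf0.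
  apply: (SIf (fun f => pd (f set0) delta = 0)) => [|f1 [invf f0]].
    split=> [|f1 f2 d1 d2|a f1 b d1]; first by rewrite ffunE pd0l.
      by rewrite ffunE pdDl d1 d2 addr0.
    by rewrite !mul_set0 mulrAC pdMl d1 linear0.
  by have [fs fr] := invariant_set0 invf; apply: pd_delta_invariant.
- by rewrite dxE odot_pdO Ig // linear0.
have [_ SIcf] := SI_parity_contraction k SIf.
by rewrite odot_euler !Ig // !linear0 addr0.
Qed.

End InverseSystemClosed.

(** * Generation of the inverse system *)

Section Generation.
Variables (K : numClosedFieldType) (n r : nat).
Hypothesis r_gt0 : (0 < r)%N.
Local Notation S := {mpoly K[n]}.
Local Notation Om := (Omega K n).
Implicit Types (a b p : S) (f g h : Om) (U V J : {set 'I_n}) (A : 'M[K]_n).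
Local Notation theta := (@theta K n).
Local Notation dtheta := (@dtheta K n).
Local Notation delta := (delta K n r).
Local Notation SI := (@SI K n r).
Local Notation pw := (pw K n r).
Local Notation y i := ('X_i ^+ r : S).

Lemma invariant_pw k : Defs.invariant r (ofS (pw k)).
Proof.
move=> A /wreath_monomial[w [c cP]]; rewrite act_ofS; congr ofS.
rewrite raddf_sum [RHS](reindex_inj (@perm_inj _ w)) /=; apply: eq_bigr => i _.
have [cr ax _] := cP i.
rewrite !rmorphXn /= comp_mpolyXU -tnth_nth tnth_mktuple ax exprZn cr.
by rewrite scale1r.
Qed.

(* Up to a scalar, [dpw k] is the differential of [pw k.+1]. *)
Definition dpw k : Om := \sum_i ofS ('X_i ^+ (r * k + r.-1)) * theta i.

Lemma invariant_dpw k : Defs.invariant r (dpw k).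
Proof.
move=> A /wreath_monomial[w [c cP]].
have a0 : act A 0 = 0 by rewrite -[X in act A X](subrr (1 : Om)) actB subrr.
rewrite /dpw (big_morph (act A) (actD A) a0).
rewrite [RHS](reindex_inj (@perm_inj _ w)) /=; apply: eq_bigr => i _.
have [cr ax at_] := cP i.
rewrite act_mul_ofS act_thetaE rmorphXn /= comp_mpolyXU -tnth_nth tnth_mktuple ax at_.
rewrite exprZn ofSZ -scalerAl -scalerAr scalerA -exprSr.
by rewrite -addnS prednK // exprD exprM cr expr1n mul1r scale1r.
Qed.

Lemma odot_suml (I : Type) (s : seq I) (P : pred I) (F : I -> Om) g :
  odot (\sum_(i <- s | P i) F i) g = \sum_(i <- s | P i) odot (F i) g.
Proof. by elim/big_rec2: _ => [|i h f _ <-]; [exact: odot0l | exact: odotDl]. Qed.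

Lemma inverse_system_pw g k U : inverse_system SI g -> (0 < k)%N ->
  pd (pw k) (g U) = 0.
Proof.
move=> Ig k_gt0; have := Ig (ofS (pw k)); rewrite -[ofS _]mulr1 odot_ofS odot1.
move=> /(_ _)/ffunP/(_ U); rewrite !ffunE; apply.
rewrite mulr1; apply: SI_gen; first exact: invariant_pw.
rewrite ffunE eqxx raddf_sum big1 //= => i _; rewrite -exprM mpolyXn mcoeffX.
case: eqP => // /(congr1 (@mdeg n)); rewrite mdegMn mdeg1 mdeg0 mul1n => /eqP.
by rewrite muln_eq0 !eqn0Ngt r_gt0 k_gt0.
Qed.

Lemma inverse_system_dpw g k : inverse_system SI g -> odot (dpw k) g = 0.
Proof.
move=> Ig; apply: Ig; apply: SI_gen; first exact: invariant_dpw.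
rewrite /dpw sum_ffunE raddf_sum big1 //= => i _.
by rewrite mul_set0 theta_set0 mulr0 mcoeff0.
Qed.

(** Its coefficients are the multipliers that combine operators built on x_i^(rk+e), over all k,
    into one whose i-th term vanishes for i in B. *)
Definition gap_poly (B : {set 'I_n}) : {poly S} := \prod_(l in B) ('X - (y l)%:P).

Lemma horner_gap_poly B x : (gap_poly B).[x] = \prod_(l in B) (x - y l).
Proof. by rewrite horner_prod; apply: eq_bigr => l _; rewrite !hornerE. Qed.

Lemma sum_gap_poly B e i :
  \sum_(k < size (gap_poly B)) (gap_poly B)`_k * 'X_i ^+ (r * k + e) =
  'X_i ^+ e * \prod_(l in B) (y i - y l).
Proof.
rewrite -horner_gap_poly horner_coef mulr_sumr; apply: eq_bigr => k _.
by rewrite exprD exprM mulrA mulrC.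
Qed.

Definition wt U : nat := (\sum_(i in U) i)%N.

(* In the component theta_(J - j) of the contraction by a suitable combination of
   the [dpw k], the terms g_(J - j + i) with i < j get the coefficient 0 and those
   with i > j have larger weight. *)
Lemma inverse_system_col g J j : inverse_system SI g -> j \in J ->
  (forall U, (wt J < wt U)%N -> g U = 0) -> pd (col_gen K r J j) (g J) = 0.
Proof.
move=> Ig jJ g0; pose B := lower_gap J j; pose f : Om :=
  \sum_(k < size (gap_poly B)) ofS (gap_poly B)`_k * dpw k.
have : odot f g = 0.
  rewrite odot_suml big1 // => k _.
  by rewrite odot_ofS inverse_system_dpw // linear0.
have -> : odot f g = \sum_i pdO ('X_i ^+ r.-1 * \prod_(l in B) (y i - y l)) (dtheta i g).
  under [RHS]eq_bigr => i _ do rewrite -sum_gap_poly pdO_suml.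
  rewrite exchange_big odot_suml; apply: eq_bigr => k _ /=.
  rewrite odot_ofS odot_suml linear_sum; apply: eq_bigr => i _ /=.
  by rewrite odot_ofS -[theta i]mulr1 odot_theta odot1 -pdOM.
move/ffunP/(_ (J :\ j)); rewrite sum_ffunE (bigD1 j) //= [X in _ + X]big1.
  rewrite !ffunE addr0 setD11 setD1K // sign_mulE linearZ => /eqP.
  by rewrite scaler_eq0 signr_eq0 => /eqP.
move=> i nij; rewrite !ffunE !inE nij /=; case: ifPn => iJ; first by rewrite linear0.
have [lij|lji|/val_inj ij] := ltngtP i j; last by rewrite ij eqxx in nij.
  by rewrite (bigD1 i) ?inE ?lij //= subrr mul0r mulr0 pd0l.
rewrite g0 ?mulr0 ?linear0 // /wt big_setU1 ?inE ?negb_and ?iJ ?orbT //=.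
by rewrite (big_setD1 j jJ) /= ltn_add2r.
Qed.

Section Closed.
Variable W : Om -> Prop.
Hypothesis closedW : operator_closed r W.

Lemma closedZ c f : W f -> W (c *: f).
Proof.
by case: closedW => [[W0 WP] _ _ _] Wf; rewrite -[_ *: _]addr0; apply: WP.
Qed.

Lemma closedD f g : W f -> W g -> W (f + g).
Proof.
by case: closedW => [[W0 WP] _ _ _] Wf Wg; rewrite -[f]scale1r; apply: WP.
Qed.

Lemma closed_sum (I : Type) (s : seq I) (P : pred I) (F : I -> Om) :
  (forall i, P i -> W (F i)) -> W (\sum_(i <- s | P i) F i).
Proof.
move=> WF; elim/big_rec: _ => [|i f Pi Wf]; first by case: closedW => [[]].
by apply: closedD => //; apply: WF.
Qed.

Lemma closed_pdO a f : W f -> W (pdO a f).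
Proof.
elim/mpoly_ring_ind: a f => [f|c a IHa f|a b IHa IHb f|i a IHa f] Wf.
- by rewrite pdO1l.
- by rewrite pdOZl; apply/closedZ/IHa.
- by rewrite pdODl; apply: closedD; [apply: IHa|apply: IHb].
- by rewrite pdOM -dxE; case: closedW => _ _ Wdx _; apply/Wdx/IHa.
Qed.

End Closed.

Definition upper (j : 'I_n) := [set t : 'I_n | (j < t)%N].

(** Up to sign, this inserts theta_i with the differential operator x_i \prod_(t > j) (y_i - y_t),
    which is zero for i > j. *)
Definition raise j f : Om := \sum_(k < size (gap_poly (upper j)))
  pdO (gap_poly (upper j))`_k (euler (k * r + 1) f).

Lemma closed_raise W j f : operator_closed r W -> W f -> W (raise j f).
Proof.
move=> cW Wf; apply: closed_sum => // k _; apply: closed_pdO => //.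
case: (cW) => _ _ _ We; apply: We => //; apply: leq_trans (ltn_ord k) _.
(* At most n - 1 indices exceed j, so there are at most n coefficients and only Euler operators with
   k < n occur. *)
rewrite /gap_poly -big_enum /= size_prod_XsubC -cardE -[X in (_ <= X)%N]card_ord.
rewrite -cardsT (cardsD1 j) inE add1n ltnS subset_leq_card //.
by apply/subsetP => t; rewrite !inE andbT; apply: contraTneq => ->; rewrite ltnn.
Qed.

Lemma raiseE j f U : raise j f U = \sum_(i in U)
  (-1) ^+ (#|[set l in U | (l < i)%N]| + #|U :\ i|) *:
    pd ('X_i * \prod_(t in upper j) (y i - y t)) (f (U :\ i)).
Proof.
rewrite [RHS]big_mkcond /raise sum_ffunE.
under [RHS]eq_bigr => i _ do rewrite -['X_i in X in pd X _]expr1 -sum_gap_poly.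
rewrite (eq_bigr (fun k : 'I_(size (gap_poly (upper j))) => \sum_i
   if i \in U then (-1) ^+ (#|[set l in U | (l < i)%N]| + #|U :\ i|) *:
    pd ((gap_poly (upper j))`_k * 'X_i ^+ (r * k + 1)) (f (U :\ i)) else 0)).
  rewrite exchange_big; apply: eq_bigr => i _ /=; case: ifP => _; last by rewrite big1.
  by rewrite pd_suml scaler_sumr.
move=> k _; rewrite ffunE eulerE sum_ffunE linear_sum; apply: eq_bigr => i _ /=.
rewrite theta_mull ffunE; case: ifP => _; last by rewrite linear0.
by rewrite !ffunE sign_mulE scalerA -exprD linearZ /= -pdMl mulnC.
Qed.

(** The operators [raise j] are applied to [delta] for the elements j of J in turn. Each inserts
    only indices up to j, so it raises the weight by at most j, and by exactly j only through j
    itself. *)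
Lemma raised_delta J : exists u : Om,
  [/\ forall W, operator_closed r W -> W u,
      u J = pd (upper_factors K r J) delta &
      forall U, U != J -> (wt J <= wt U)%N -> u U = 0].
Proof.
move eqk: #|J| => k; elim: k J eqk => [|k IHk] J cardJ.
  exists (ofS delta); split=> [W []//||U].
    by rewrite (cards0_eq cardJ) ffunE eqxx /upper_factors big_set0 pd1l.
  by rewrite (cards0_eq cardJ) ffunE => /negbTE ->.
have [j jJ] : exists j, j \in J by apply/card_gt0P; rewrite cardJ.
have cardJ0 : #|J :\ j| = k by move: cardJ; rewrite (cardsD1 j) jJ => -[].
have [u [uW uJ u0]] := IHk _ cardJ0.
pose e := (#|[set l in J | (l < j)%N]| + #|J :\ j|)%N.
have wtD (U : {set 'I_n}) i : i \in U -> wt U = (i + wt (U :\ i))%N.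
  by move=> iU; rewrite /wt (big_setD1 i iU).
have term0 U i : (wt J <= wt U)%N -> i \in U -> (i != j) || (U != J) ->
    pd ('X_i * \prod_(t in upper j) (y i - y t)) (u (U :\ i)) = 0.
  move=> wJU iU ne; have [lji|lij] := ltnP j i.
    by rewrite (bigD1 i) ?inE //= subrr mul0r mulr0 pd0l.
  rewrite (wtD J j jJ) (wtD U i iU) in wJU.
  rewrite u0 ?linear0 //; last first.
    by rewrite -(leq_add2l j) (leq_trans wJU) // leq_add2r.
  apply: contraTneq wJU => UJ; rewrite UJ leq_add2r -ltnNge ltn_neqAle lij andbT.
  apply: contraL ne => /eqP/val_inj ij; rewrite negb_or !negbK ij eqxx /=.
  by rewrite -(setD1K iU) UJ ij setD1K.
exists ((-1) ^+ e *: raise j u); split=> [W cW||U nUJ wJU].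
- by apply: closedZ => //; apply: closed_raise => //; apply: uW.
- rewrite ffunE raiseE (bigD1 j) //= [X in _ + X]big1 ?addr0 => [|i /andP[iJ nij]].
    rewrite scalerA -exprD addnn -signr_odd odd_double scale1r uJ -pdMl.
    by rewrite /upper_factors (big_setD1 j jJ).
  by rewrite term0 ?nij // scaler0.
- rewrite ffunE raiseE big1 ?scaler0 // => i iU.
  by rewrite term0 ?nUJ ?orbT // scaler0.
Qed.

Lemma inverse_system_generated g : inverse_system SI g ->
  forall W, operator_closed r W -> W g.
Proof.
have Iclosed := inverse_system_closed K n r_gt0.
have delta_gen q : harmonic r q -> exists a, q = pd a delta.
  apply: harmonic_cyclic => // [|i q' hq'|].
  - exact: harmonic_delta.
  - have [a ->] := delta_factor K r_gt0 i; rewrite pdMl.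
    have cfT := config_indicator K r [set: 'I_n].
    have [w w0 pwE] := pd_pw_cfg r_gt0 cfT (in_setT i).
    have cq' : cfgV (fun i => (i \in [set: 'I_n])%:R : K) id q'.
      by move=> k; rewrite inE scale1r.
    have pq' k : (0 < k < #|[set: 'I_n]|)%N -> pd (pw k) q' = 0.
      by rewrite cardsT card_ord => /andP[k0 kn]; apply: hq'; rewrite k0 ltnW.
    have n_gt0 : (0 < n)%N by apply: leq_ltn_trans (ltn_ord i).
    have /esym/eqP := pwE q' cq' pq'; rewrite cardsT card_ord hq' ?n_gt0 ?leqnn //.
    rewrite scaler_eq0 (negbTE w0) setTD => /eqP ->.
    exact: linear0.
  - exact: pd_delta_delta.
(* Induction on a strict upper bound N for the weights of the nonzero components, starting just
   above the weight of the full set. *)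
move=> Ig W cW; move: {2}(wt _).+1 (leqnn (wt [set: 'I_n]).+1) => N wtN.
have : forall U, (N <= wt U)%N -> g U = 0.
  move=> U NU; have : (wt U <= wt [set: 'I_n])%N.
    rewrite /wt big_mkcond [leqRHS]big_mkcond leq_sum // => i _.
    by rewrite inE; case: ifP.
  by rewrite leqNgt (leq_trans wtN NU).
elim: N g {wtN} Ig => [|N IHN] g Ig g0.
  have -> : g = 0 by apply/ffunP => U; rewrite g0 // ffunE.
  by case: cW => [[]].
have /fin_all_exists[a aP] J : exists a, wt J = N -> g J = pd a (pd (upper_factors K r J) delta).
  have [wJ|nwJ] := eqVneq (wt J) N; last by exists 0 => wJ; rewrite wJ eqxx in nwJ.
  have [k /andP[k0 _]|i iJ|a ->] := linkage r_gt0 delta_gen (J := J) (q := g J).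
  - exact: inverse_system_pw.
  - by apply: inverse_system_col => // U; rewrite wJ => /g0.
  - by exists a.
have /fin_all_exists[u uP] := raised_delta.
(* [h] agrees with [g] in weight N and has no component of larger weight. It lies in every closed
   space, in particular in the inverse system, so [g - h] stays there while its weight bound
   drops. *)
pose h : Om := \sum_(J | wt J == N) pdO (a J) (u J).
have hW W' : operator_closed r W' -> W' h.
  move=> cW'; apply: closed_sum => // J _; apply: closed_pdO => //.
  by have [uW _ _] := uP J; apply: uW.
rewrite -[g](subrK h); apply: closedD => //; last exact: hW.
apply: IHN.
  rewrite addrC -scaleN1r; case: (Iclosed) => [[_ IP] _ _ _].
  by apply: IP => //; apply: hW.
move=> U; rewrite leq_eqVlt => /predU1P[NU|NU].
  rewrite !ffunE sum_ffunE (bigD1 U) ?NU //= big1 ?addr0 => [|J /andP[/eqP wJ nJU]].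
    by have [_ uU _] := uP U; rewrite ffunE uU -aP // subrr.
  by have [_ _ uJ] := uP J; rewrite ffunE uJ ?linear0 ?wJ ?NU // eq_sym.
rewrite !ffunE sum_ffunE big1 ?subr0 ?g0 // => J /eqP wJ.
have [_ _ uJ] := uP J; rewrite ffunE uJ ?linear0 ?wJ ?(ltnW NU) //.
by apply: contraTneq NU => ->; rewrite wJ ltnn.
Qed.

End Generation.

From mathcomp Require Import reals complex.


Theorem theorem3p20 (R : realType) (n r : nat) (n_gt0 : (0 < n)%N)
    (r_gt0 : (0 < r)%N) :
  operator_closed r (inverse_system (@SI (complex R) n r)) /\
  forall W : Omega (complex R) n -> Prop, operator_closed r W ->
    forall g, inverse_system (SI r) g -> W g.
Proof.
split; first exact: (@inverse_system_closed (complex R) n r r_gt0).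
move=> W cW g Ig.
exact: (@inverse_system_generated (complex R) n r r_gt0 g Ig W cW).
Qed.
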